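(* Let $n\ge1$ and $p\ge 1$ be integers. Suppose that $P_{2p}(x)$ is a homogeneous polynomial of degree $2p$ on $\mathbb{R}^n$ which is elliptic, i.e. there exists $\delta>0$ such that $P_{2p}(x)\ge\delta|x|^{2p}$ for all $x\in\mathbb{R}^n$. Let $0\le k_0\le p$ be an integer, $R>0$ a positive number, $a_\alpha(x)$ functions in $A(B_R)$ for every multi-index $\alpha\in\mathbb{N}_0^n$ with $|\alpha|\le k_0$, and $$L=\Delta^p+\sum_{|\alpha|\le k_0}a_\alpha(x)D^\alpha .$$ (i) If $k_0<p$, then the operator $q\mapsto L(P_{2p}\,q)$ is a bijection from $A(B_R)$ onto $A(B_R)$. (ii) If $k_0=p$, then there exists $r>0$ such that the equation $L(P_{2p}\,q)=f$ has a unique solution $q\in A(B_r)$ for every $f\in A(B_R)$.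
   Context: $B_R:=\{x\in\mathbb{R}^n:|x|<R\}$. $A(B_R)$ is the algebra of all infinitely differentiable functions $f:B_R\to\mathbb{C}$ such that for any compact subset $K\subset B_R$ the homogeneous Taylor series $\sum_{m=0}^\infty f_m(x)$ converges absolutely and uniformly to $f$ on $K$, where $f_m(x)=\sum_{|\alpha|=m}\frac{1}{\alpha!}\frac{\partial^\alpha f}{\partial x^\alpha}(0)x^\alpha$. $\Delta=\sum_{j=1}^n\partial^2/\partial x_j^2$ is the Laplace operator and $D^\alpha=\partial^{|\alpha|}/\partial x_1^{\alpha_1}\cdots\partial x_n^{\alpha_n}$. *)

(* Defs.v *)
From HB Require Import structures.
From mathcomp Require Import all_boot all_order all_algebra.
From mathcomp Require Import boolp classical_sets functions.
From mathcomp Require Import reals topology normedtype sequences derive.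
From mathcomp.real_closed Require Export complex.
(* The notations of mpoly clash with those of analysis. *)
From mathcomp.multinomials Require Import (coercions, canonicals) mpoly.

Set Implicit Arguments.
Unset Strict Implicit.
Unset Printing Implicit Defensive.

Import Order.TTheory GRing.Theory Num.Theory.
Import numFieldNormedType.Exports.

Local Open Scope classical_set_scope.
Local Open Scope ring_scope.

(* [Rcomplex R] is the field [R[i]] with its [R]-linear structure and its
   [R]-valued modulus.  The instances below turn it into a normed [R]-module,
   so that complex-valued functions of real variables can be differentiated. *)
Section RcomplexNormedModule.
Variable R : realType.

HB.instance Definition _ :=
  PseudoMetric.copy (Rcomplex R) (pseudoMetric_normed (Rcomplex R)).
HB.instance Definition _ := isPointed.Build (Rcomplex R) 0.
HB.instance Definition _ :=
  NormedZmod_PseudoMetric_eq.Build R (Rcomplex R) erefl.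

Lemma Rcomplex_normrZ (l : R) (z : Rcomplex R) : `|l *: z| = `|l| * `|z|.
Proof.
case: z => a b; rewrite /Num.norm /= !exprMn -mulrDr sqrtrM ?sqr_ge0 //.
by rewrite sqrtr_sqr.
Qed.

HB.instance Definition _ :=
  PseudoMetricNormedZmod_Lmodule_isNormedModule.Build R (Rcomplex R)
    Rcomplex_normrZ.

End RcomplexNormedModule.

Section AnalyticBall.
Variables (R : realType) (n : nat).
Local Notation E := 'rV[R]_n.
Local Notation C := (Rcomplex R).
Local Notation multi := (mpoly.multinom n).

(* The library norm on ['rV[R]_n] is the sup norm. *)
Definition enorm (x : E) : R := Num.sqrt (\sum_i x 0 i ^+ 2).

Definition eball (r : R) : set E := [set x | enorm x < r].

Definition partial (i : 'I_n) (f : E -> C) : E -> C :=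
  fun x => 'D_(delta_mx 0 i) f x.

Definition Dmulti (alpha : multi) (f : E -> C) : E -> C :=
  foldr (fun i g => iter (alpha i) (partial i) g) f (enum 'I_n).

Definition laplacian (f : E -> C) : E -> C :=
  fun x => \sum_i partial i (partial i f) x.

Definition mfact (alpha : multi) : nat := \prod_i (alpha i)`!.

Definition mpow (x : E) (alpha : multi) : R := \prod_i x 0 i ^+ alpha i.

Definition taylor (f : E -> C) (m : nat) (x : E) : C :=
  \sum_(alpha : mpoly.bmultinom n m.+1 | mpoly.mdeg alpha == m)
    ((mfact alpha)%:R^-1 * mpow x alpha) *: Dmulti alpha f 0.

(* All iterated partial derivatives, in any order of differentiation, exist
   and are continuous at every point of [D]; only meant for open [D]. *)
Definition smooth_on (D : set E) (f : E -> C) : Prop :=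
  forall (s : seq 'I_n) (x : E), D x ->
    {for x, continuous (foldr partial f s)} /\
    (forall i, derivable (foldr partial f s) x (delta_mx 0 i)).

(* A function on the ball of radius [r] is represented by its extension by 0,
   so that equality in [analytic_ball r] is equality on the ball. *)
Definition analytic_ball (r : R) : set (E -> C) := [set f |
  [/\ forall x, ~ eball r x -> f x = 0,
      smooth_on (eball r) f
    & forall K : set E, compact K -> K `<=` eball r ->
        (forall x, K x -> cvgn (series (fun m => `|taylor f m x|))) /\
        {uniform K, (fun N x => series (fun m => taylor f m x) N) @ \oo --> f}]].

Definition elliptic (P : mpoly.mpoly n R) (d : nat) : Prop :=
  exists2 delta : R, 0 < delta &
    forall x : E, delta * enorm x ^+ d <= mpoly.meval (x 0) P.

Definition diffop (p k0 : nat) (a : multi -> E -> C) (f : E -> C) : E -> C :=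
  fun x => iter p laplacian f x +
    \sum_(alpha : mpoly.bmultinom n k0.+1) a alpha x * Dmulti alpha f x.

Definition pmul (P : mpoly.mpoly n R) (q : E -> C) : E -> C :=
  fun x => mpoly.meval (x 0) P *: q x.

End AnalyticBall.

(* Main.v *)
(* Write the homogeneous expansion [q = \sum_m q_m].  The equation
   [L (P q) = f] becomes a recursion [Delta^p (P q_m) = f_m - G_m], where [G_m]
   only involves the [q_l] with [l < m], because a derivative of order at most
   [p] cannot compensate the degree [2p] of [P].

   The Fischer operator [q |-> Delta^p (P q)] on the homogeneous polynomials of
   degree [m] is controlled in [L^2] of the unit sphere.  With [R = |x|^2], the
   operator [R^p Delta^p] is self-adjoint in degree [m + 2p], so if [g] solves
   [Delta^p (R^p g) = q] then
     [delta |q|^2 <= <P q, q> = <Delta^p (P q), g> <= |Delta^p (P q)| |g|],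
   and [(m + 1)^p |g| <= |q|] since [Delta^p R^p] is a product of operators
   [R Delta + kappa] with [R Delta >= 0] and [kappa >= m + 1].  Hence
   [|q_m| <= delta^-1 (m + 1)^-p |f_m - G_m|].  As [k0] derivatives cost at most
   a factor [O(m^k0)] (Bernstein), the recursion is eventually a contraction when
   [k0 < p], and it is one on small balls when [k0 = p].

   No integration over the sphere is used: the mean of a homogeneous polynomial
   [h] of degree [2d] is the constant [Delta^d h / Delta^d R^d]. *)

Require Import Defs.
From HB Require Import structures.
From mathcomp Require Import all_boot all_order all_algebra ring lra zify.
From mathcomp Require Import boolp.
From mathcomp.real_closed Require Import polyrcf.

Set Implicit Arguments.
Unset Strict Implicit.
Unset Printing Implicit Defensive.

Import Order.TTheory GRing.Theory Num.Theory.

Local Open Scope ring_scope.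

(* The notations of mpoly clash with those of analysis; the module confines
   them. *)
Module HomogeneousPolynomials.

From mathcomp.multinomials Require Import mpoly.

(** * Laplacian and sphere means *)

Section Operators.
Variables (R : rcfType) (n : nat).
Local Notation M := {mpoly R[n]}.
Implicit Types (p q g h u v w : M) (i j : 'I_n).

Lemma mderivXU i j : ('X_i : M)^`M(j) = (i == j)%:R.
Proof.
rewrite mderivX mnm1E; have [->|_] := eqVneq i j; last by rewrite scale0r.
by rewrite scale1r -[X in 'X_[X]](_ : 0%MM = _) ?mpolyX0 //; apply/mnmP => k;
  rewrite mnmBE mnm0E subnn.
Qed.

Definition lap p : M := \sum_i p^`M(i)^`M(i).

Lemma lap_is_linear : linear lap.
Proof.
move=> c p q; rewrite /lap scaler_sumr -big_split; apply: eq_bigr => i _.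
by rewrite !linearP.
Qed.
HB.instance Definition _ := GRing.isLinear.Build R M M _ lap lap_is_linear.

Lemma lapD p q : lap (p + q) = lap p + lap q. Proof. exact: linearD. Qed.
Lemma lapMn p k : lap (p *+ k) = lap p *+ k. Proof. exact: linearMn. Qed.

Definition lapn k p : M := iter k lap p.

Lemma lapn_is_linear k : linear (lapn k).
Proof. by move=> c p q; rewrite /lapn; elim: k => //= k ->; rewrite linearP. Qed.
HB.instance Definition _ k :=
  GRing.isLinear.Build R M M _ (lapn k) (lapn_is_linear k).

Lemma lapnS k p : lapn k.+1 p = lap (lapn k p). Proof. by []. Qed.
Lemma lapnSr k p : lapn k.+1 p = lapn k (lap p). Proof. exact: iterSr. Qed.
Lemma mderiv_lap i p : (lap p)^`M(i) = lap p^`M(i).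
Proof.
rewrite /lap linear_sum; apply: eq_bigr => j _ /=.
by rewrite !(mderiv_comm _ i).
Qed.

Lemma mderiv_lapn i k p : (lapn k p)^`M(i) = lapn k p^`M(i).
Proof. by elim: k => //= k IH; rewrite mderiv_lap IH. Qed.

Lemma lap_mulX i v : lap ('X_i * v) = 'X_i * lap v + v^`M(i) *+ 2.
Proof.
rewrite /lap mulr_sumr; transitivity
  (\sum_j ('X_i * v^`M(j)^`M(j) + (if j == i then v^`M(i) *+ 2 else 0))).
  apply: eq_bigr => j _; rewrite mderivM mderivD !mderivM !mderivXU.
  have [->|_] := eqVneq j i.
    rewrite [true%:R]mulr1n -mpolyC1 mderivC mpolyC1; ring.
  by rewrite [false%:R]mulr0n mderiv0 !mul0r !add0r addr0.
by rewrite big_split /= -big_mkcond big_pred1_eq.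
Qed.

Lemma lapn_mulX i k v :
  lapn k ('X_i * v) = 'X_i * lapn k v + (lapn k.-1 v^`M(i)) *+ (2 * k).
Proof.
elim: k => [|k IH]; first by rewrite muln0 mulr0n addr0.
rewrite lapnS IH lapD lap_mulX lapMn -!lapnS mderiv_lapn.
case: k {IH} => [|k]; first by rewrite !muln0 !mulr0n addr0.
by rewrite -addrA; congr (_ + _); rewrite -mulrnDr; congr (_ *+ _); lia.
Qed.

Definition rad2 : M := \sum_i 'X_i ^+ 2.

Definition euler v : M := \sum_i 'X_i * v^`M(i).

Lemma lap_mul_rad2 v : lap (rad2 * v) = rad2 * lap v + euler v *+ 4 + v *+ (2 * n).
Proof.
rewrite mulr_suml linear_sum /=.
under eq_bigr do rewrite expr2 -mulrA !lap_mulX mderivM mderivXU eqxx mul1r.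
rewrite (eq_bigr (fun i => 'X_i ^+ 2 * lap v + ('X_i * v^`M(i)) *+ 4 + v *+ 2));
  last by move=> i _; ring.
rewrite !big_split /= -mulr_suml.
by rewrite sumr_const card_ord mulnC mulrnA -/rad2 -/(euler v); ring.
Qed.

Local Notation "d .-homog" := (@ishomog1 _ _ d (@mdeg n)) : ring_scope.

Lemma homogP d p :
  reflect (forall m, p@_m != 0 -> mdeg m = d) (p \is d.-homog).
Proof.
apply: (iffP (dhomogP _ _ _)) => h m; first by rewrite -mcoeff_msupp; apply: h.
by rewrite mcoeff_msupp; apply: h.
Qed.

Lemma mderiv_homog i d p : p \is d.-homog -> p^`M(i) \is d.-1.-homog.
Proof.
move=> /homogP hp; apply/homogP => m; rewrite mcoeff_mderiv => h.
have: p@_(m + U_(i)) != 0 by apply: contraNneq h => ->; rewrite mul0rn.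
by move/hp; rewrite mdegD mdeg1 => <-; rewrite addn1.
Qed.

Lemma mderiv_homog0 i p : p \is 0.-homog -> p^`M(i) = 0.
Proof.
move=> /homogP hp; apply/mpolyP => m; rewrite mcoeff_mderiv mcoeff0.
have [->|/hp] := eqVneq (p@_(m + U_(i))) 0; first by rewrite mul0rn.
by rewrite mdegD mdeg1 addn1.
Qed.

Lemma lap_homog d p : p \is d.-homog -> lap p \is d.-2.-homog.
Proof. by move=> hp; apply: rpred_sum => i _; do 2 apply: mderiv_homog. Qed.

Lemma lap_homog_lt2 d p : (d < 2)%N -> p \is d.-homog -> lap p = 0.
Proof.
move=> hd hp; apply: big1 => i _; apply: mderiv_homog0.
by have := mderiv_homog i hp; case: d hd {hp} => [|[|]].
Qed.

Lemma lapn_homog k d p : p \is d.-homog -> lapn k p \is (d - k.*2).-homog.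
Proof.
elim: k => [|k IH] hp; first by rewrite subn0.
by rewrite lapnS -[(_ - _)%N](_ : (d - k.*2).-2 = _) ?lap_homog ?IH //; lia.
Qed.

Lemma lapn_homog_eq0 k d p : (d < k.*2)%N -> p \is d.-homog -> lapn k p = 0.
Proof.
case: k => // k hd hp; rewrite lapnS; apply: (@lap_homog_lt2 (d - k.*2)); first lia.
exact: lapn_homog.
Qed.

Lemma homogX i : ('X_i : M) \is 1.-homog.
Proof. by rewrite dhomogX; apply/eqP; apply: mdeg1. Qed.

Lemma homogM d e p q :
  p \is d.-homog -> q \is e.-homog -> p * q \is (d + e).-homog.
Proof. exact: dhomogM. Qed.

Lemma homogXn k d p : p \is d.-homog -> p ^+ k \is (d * k).-homog.
Proof. exact: dhomogMn. Qed.

Lemma rad2_homog : rad2 \is 2.-homog.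
Proof. by apply: rpred_sum => i _; apply: (homogXn 2 (homogX i)). Qed.

Lemma rad2n_homog k : rad2 ^+ k \is k.*2.-homog.
Proof. by rewrite -mul2n; apply: homogXn rad2_homog. Qed.

Lemma rad2M_homog k d p : p \is d.-homog -> rad2 ^+ k * p \is (k.*2 + d).-homog.
Proof. exact/homogM/rad2n_homog. Qed.

Lemma euler_homog d p : p \is d.-homog -> euler p = p *+ d.
Proof.
move=> /homogP hp; have XE i m : 'X_i * 'X_[m]^`M(i) = 'X_[m] *+ (m i) :> M.
  rewrite mderivX -scalerAr -mpolyXD -scaler_nat.
  have [->|hm] := eqVneq (m i) 0%N; first by rewrite !scale0r.
  by rewrite addmC submK // lep1mP.
rewrite [in LHS](mpolyE p) [in RHS](mpolyE p) /euler -sumrMnl.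
under eq_bigr do rewrite linear_sum mulr_sumr.
rewrite exchange_big /= [LHS]big_seq [RHS]big_seq; apply: eq_bigr => m.
rewrite mcoeff_msupp => /hp <-.
under eq_bigr do rewrite linearZ /= -scalerAr XE -scalerMnr.
by rewrite mdegE sumrMnr.
Qed.

Lemma lap_rad2M d p : p \is d.-homog ->
  lap (rad2 * p) = rad2 * lap p + p *+ (4 * d + 2 * n).
Proof. by move=> /euler_homog h; rewrite lap_mul_rad2 h; ring. Qed.

Lemma lap_rad2nM k d p : p \is d.-homog ->
  lap (rad2 ^+ k.+1 * p) =
  rad2 ^+ k.+1 * lap p + rad2 ^+ k * p *+ (2 * k.+1 * (2 * d + 2 * k + n)).
Proof.
move=> hp; elim: k => [|k IH].
  by rewrite expr1 expr0 (lap_rad2M hp); congr (_ + _); rewrite mul1r; congr (_ *+ _); lia.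
rewrite exprS -mulrA (lap_rad2M (rad2M_homog k.+1 hp)) IH.
rewrite mulrDr mulrA -exprS -addrA mulrnAr mulrA -exprS -mulrnDr.
by congr (_ + _ *+ _); lia.
Qed.

(* [lapc d] is the value of [lapn d (rad2 ^+ d)]. *)
Fixpoint lapc (d : nat) : nat :=
  if d is d'.+1 then (2 * d'.+1 * (2 * d' + n) * lapc d')%N else 1%N.

(* By Pizzetti's formula this is the mean over the unit sphere of a homogeneous
   [h] of degree [2d]. *)
Definition sph d h : R := (lapn d h)@_0%MM / (lapc d)%:R.

Lemma sph_is_linear d : linear_for *%R (sph d).
Proof. by move=> c p q; rewrite /sph linearP /= mcoeffD mcoeffZ mulrDl mulrA. Qed.
HB.instance Definition _ d :=
  GRing.isLinear.Build R M R _ (sph d) (sph_is_linear d).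

Hypothesis n_gt0 : (0 < n)%N.

Lemma lapc_gt0 d : (0 < lapc d)%N.
Proof. by elim: d => //= d IH; rewrite !muln_gt0 IH addn_gt0 n_gt0 orbT. Qed.

Lemma lapc_neq0 d : (lapc d)%:R != 0 :> R.
Proof. by rewrite pnatr_eq0 -lt0n lapc_gt0. Qed.

Lemma mcoeff0M p q : (p * q)@_0%MM = p@_0%MM * q@_0%MM.
Proof. exact: rmorphM. Qed.

Lemma natr_neq0 k : (0 < k)%N -> (k%:R : R) != 0.
Proof. by rewrite pnatr_eq0 -lt0n. Qed.

Lemma sph_mderiv d i v : sph d v^`M(i) = (2 * d + n)%:R * sph d.+1 ('X_i * v).
Proof.
rewrite /sph lapn_mulX mcoeffD mcoeffMn mcoeff0M mcoeffX mnm1_eq0 mul0r add0r.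
rewrite -mulr_natr [lapc d.+1]/= !natrM.
by field; rewrite lapc_neq0 -natrM -natrD nat1r !natr_neq0 ?addn_gt0 ?n_gt0 ?orbT.
Qed.

Lemma sph_rad2M d h : sph d.+1 (rad2 * h) = sph d h.
Proof.
have hn : (2 * d + n)%:R != 0 :> R by apply: natr_neq0; rewrite addn_gt0 n_gt0 orbT.
have E i : (2 * d + n)%:R * sph d.+1 ('X_i * ('X_i * h)) =
    sph d h + sph d ('X_i * h^`M(i)).
  by rewrite -sph_mderiv mderivM mderivXU eqxx mulr1n mul1r linearD.
apply: (mulfI hn); rewrite mulr_suml linear_sum mulr_sumr /=.
under eq_bigr do rewrite expr2 -mulrA E.
rewrite big_split /= sumr_const card_ord.
have F i : sph d ('X_i * h^`M(i)) =
  (lapn d.-1 h^`M(i)^`M(i))@_0%MM * (2 * d)%:R / (lapc d)%:R.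
  by rewrite /sph lapn_mulX mcoeffD mcoeff0M mcoeffX mnm1_eq0 mul0r add0r mcoeffMn mulr_natr.
under eq_bigr do rewrite F.
rewrite -!mulr_suml -linear_sum /= -raddf_sum -/(lap h).
case: d {E F hn} => [|d]; first by rewrite !muln0 mulr0 mul0r addr0 add0n mulr_natl.
rewrite [X in X@__](_ : _ = lapn d.+1 h); last by rewrite lapnSr.
by rewrite -mulr_natr /sph natrD; ring.
Qed.

Lemma sph_rad2nM k d h : sph (k + d) (rad2 ^+ k * h) = sph d h.
Proof. by elim: k => [|k IH]; rewrite ?mul1r // exprS -mulrA sph_rad2M. Qed.

Lemma sph_rad2n d : sph d (rad2 ^+ d) = 1.
Proof.
by rewrite -[d in sph d]addn0 -[X in sph _ X]mulr1 sph_rad2nM /sph mcoeff1 eqxx mulr1n divr1.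
Qed.

Lemma sph_mul_lap_sub k l d f g :
  f \is k.-homog -> g \is l.-homog ->
  sph d (f * lap g) - sph d (lap f * g) =
  (2 * d + n)%:R * (l%:R - k%:R) * sph d.+1 (f * g).
Proof.
move=> hf hg; rewrite -linearB /=.
have -> : f * lap g - lap f * g = \sum_i (f * g^`M(i) - f^`M(i) * g)^`M(i).
  rewrite /lap mulr_sumr mulr_suml -sumrB; apply: eq_bigr => i _.
  by rewrite mderivB !mderivM; ring.
rewrite linear_sum /=; under eq_bigr do rewrite sph_mderiv.
rewrite -mulr_sumr -linear_sum -mulrA; congr (_ * _).
have -> : \sum_i 'X_i * (f * g^`M(i) - f^`M(i) * g) = f * euler g - euler f * g.
  rewrite /euler mulr_sumr mulr_suml -sumrB; apply: eq_bigr => i _; ring.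
rewrite (euler_homog hf) (euler_homog hg) mulrnAr mulrnAl linearB !linearMn /=.
by rewrite mulrBl !mulr_natl.
Qed.

Lemma sph_lapC k d f g : f \is k.-homog -> g \is k.-homog ->
  sph d (f * lap g) = sph d (lap f * g).
Proof.
move=> hf hg; apply/eqP; rewrite -subr_eq0 (sph_mul_lap_sub d hf hg).
by rewrite subrr mulr0 mul0r.
Qed.

End Operators.

Arguments lapn : simpl never.

Section Line.
Variables (R : rcfType) (n : nat).
Local Notation M := {mpoly R[n]}.
Implicit Types (p q g : M) (i j : 'I_n) (x : 'I_n -> R).

Definition line x i p : {poly R} :=
  mmap polyC (fun j => (x j)%:P + (j == i)%:R *: 'X) p.

Lemma horner_line x i p t :
  (line x i p).[t] = p.@[fun j => x j + t * (j == i)%:R].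
Proof.
rewrite /line mevalE /mmap horner_sum; apply: eq_bigr => m _.
rewrite hornerM hornerC; congr (_ * _); rewrite /mmap1 horner_prod.
by apply: eq_bigr => j _; rewrite horner_exp !hornerE mulrC.
Qed.

Lemma deriv_line x i p : (line x i p)^`() = line x i p^`M(i).
Proof.
pose Q p := (line x i p)^`() = line x i p^`M(i).
have QM p1 p2 : Q p1 -> Q p2 -> Q (p1 * p2).
  rewrite /Q /line => h1 h2; rewrite mderivM !rmorphD !rmorphM /= derivM.
  by rewrite h1 h2.
have QC c : Q c%:MP by rewrite /Q mderivC /line mmapC derivC rmorph0.
have QX j : Q 'X_j.
  rewrite /Q mderivXU /line mmapX mmap1U derivD derivC add0r derivZ derivX.
  by rewrite rmorph_nat scaler_nat.
have QXm m : Q 'X_[m].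
  rewrite mpolyXE_id; apply: (big_ind Q) => // [|j _]; first by rewrite -mpolyC1.
  by elim: (m j) => [|k IH]; rewrite ?expr0 -?mpolyC1 // exprS; apply: QM.
rewrite -/(Q p) (mpolyE p); apply: (big_ind Q) => [|p1 p2|m _].
- by rewrite -mpolyC0.
- by rewrite /Q /line => h1 h2; rewrite linearD !raddfD /= h1 h2.
- by rewrite -mul_mpolyC; apply: QM.
Qed.

(* [deg p < w], with [dlt 0] only for [p = 0]. *)
Definition dlt w p := forall m, p@_m != 0 -> (mdeg m < w)%N.

Lemma dlt_leq w w' p : (w <= w')%N -> dlt w p -> dlt w' p.
Proof. by move=> h hp m /hp /leq_trans; apply. Qed.

Lemma dlt0 w : dlt w 0. Proof. by move=> m; rewrite mcoeff0 eqxx. Qed.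

Lemma dltD w p q : dlt w p -> dlt w q -> dlt w (p + q).
Proof.
move=> hp hq m; rewrite mcoeffD.
by have [->|/hp //] := eqVneq p@_m 0; rewrite add0r; apply: hq.
Qed.

Lemma dltZ w c p : dlt w p -> dlt w (c *: p).
Proof.
move=> hp m; rewrite mcoeffZ; have [->|/hp //] := eqVneq p@_m 0.
by rewrite mulr0 eqxx.
Qed.

Lemma dlt_sum w (I : Type) (r : seq I) (P : pred I) (F : I -> M) :
  (forall k, P k -> dlt w (F k)) -> dlt w (\sum_(k <- r | P k) F k).
Proof. by move=> h; apply: (big_ind (dlt w)) => // [|p q]; [exact: dlt0|exact: dltD]. Qed.

Lemma dlt_eq0 p : dlt 0 p -> p = 0.
Proof.
move=> hp; apply/mpolyP => m; rewrite mcoeff0.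
by have [->|/hp] := eqVneq p@_m 0.
Qed.

Lemma dlt_homog d p : p \is ishomog1 d (@mdeg n) -> dlt d.+1 p.
Proof. by move=> /homogP h m /h ->. Qed.

Definition dpart i k p : M := iter k (mderiv i) p.

Arguments dpart : simpl never.

Lemma dlt_dpart w i k p : dlt w p -> dlt (w - k) (dpart i k p).
Proof.
move=> hp; elim: k => [|k IH]; first by rewrite subn0.
move=> m; rewrite /dpart iterS -/(dpart i k p) mcoeff_mderiv => h.
have: (dpart i k p)@_(m + U_(i)) != 0 by apply: contraNneq h => ->; rewrite mul0rn.
by move/IH; rewrite mdegD mdeg1; lia.
Qed.

Lemma derivn_line x i k p : (line x i p)^`(k) = line x i (dpart i k p).
Proof. by elim: k => [|k IH] //; rewrite derivnS IH deriv_line. Qed.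

Lemma meval_taylor x i w p t : dlt w p ->
  p.@[fun j => x j + t * (j == i)%:R] =
  \sum_(k < w) t ^+ k / k`!%:R * (dpart i k p).@[x].
Proof.
move=> hp; rewrite -horner_line.
set P := line x i p; have nz k : (k`!%:R : R) != 0 by rewrite pnatr_eq0 -lt0n fact_gt0.
have E k : P^`N(k).[0] = (dpart i k p).@[x] / k`!%:R.
  have := congr1 (horner^~ 0) (nderivn_def k P); rewrite derivn_line horner_line.
  rewrite hornerMn -mulr_natr => h; rewrite -[LHS](mulfK (nz k)) -h.
  by congr (_ / _); apply: meval_eq => j; rewrite mul0r addr0.
rewrite -[t]add0r (@nderiv_taylor_wide _ (size P + w)) ?leq_addr //; last first.
  exact: mulrC.
rewrite addnC big_split_ord /= [X in _ + X]big1 ?addr0 => [|k _].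
  by apply: eq_bigr => k _; rewrite E add0r; ring.
rewrite E (_ : dpart _ _ _ = 0) ?meval0 ?mul0r //.
by apply: dlt_eq0; apply: (dlt_leq _ (dlt_dpart (k := w + k) hp)); lia.
Qed.

(* The discrete Laplacian with unit steps, Taylor expanded up to order [2K]. *)
Definition cdiff K p : M :=
  \sum_i \sum_(k < K) (2 / (k.+1).*2`!%:R) *: dpart i (k.+1).*2 p.

Lemma meval_cdiff K x p : dlt K.*2 p ->
  (cdiff K p).@[x] = \sum_i (p.@[fun j => x j + 1 * (j == i)%:R] +
                      p.@[fun j => x j + (-1) * (j == i)%:R] - 2 * p.@[x]).
Proof.
move=> hp; rewrite [in LHS]linear_sum; apply: eq_bigr => i _ /=.
have {}hp : dlt (K.+1).*2 p by apply: (dlt_leq _ hp); lia.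
rewrite !(meval_taylor _ _ _ hp) -big_split /= linear_sum /=.
have D (F : nat -> R) : \sum_(k < (K.+1).*2) F k =
    \sum_(k < K.+1) (F k.*2 + F (k.*2).+1).
  elim: (K.+1) => [|N IH]; first by rewrite !big_ord0.
  by rewrite doubleS !big_ord_recr /= IH addrA.
rewrite (D (fun k => 1 ^+ k / k`!%:R * (dpart i k p).@[x] +
                     (-1) ^+ k / k`!%:R * (dpart i k p).@[x])).
rewrite (eq_bigr (fun k : 'I_K.+1 => 2 / (k.*2)`!%:R * (dpart i k.*2 p).@[x])).
  rewrite big_ord_recl double0 fact0 divr1 [X in X - _]addrC addrK.
  by apply: eq_bigr => k _; rewrite mevalZ.
move=> k _; rewrite !expr1n !exprS -mul2n !exprM sqrrN !expr1n; ring.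
Qed.

End Line.

Arguments dpart : simpl never.

(** * Positivity of the sphere mean *)

Section Positivity.
Variables (R : archiRcfType) (n : nat).
Local Notation M := {mpoly R[n]}.
Implicit Types (p q g h : M).
Local Notation "d .-homog" := (@ishomog1 _ _ d (@mdeg n)) : ring_scope.

Lemma diff_const_ge0 d (c : R) (s : nat -> nat -> R) :
  (forall k N, s k N.+1 = s k N + s k.+1 N) -> (forall N, s d N = c) ->
  (forall N, 0 <= s 0%N N) -> 0 <= c.
Proof.
move=> hs hd hpos; rewrite leNgt; apply/negP => c_lt0.
suff /(_ d (leqnn d)) : forall j, (j <= d)%N ->
    exists2 e : R, 0 < e & exists N0, forall N, (N0 <= N)%N -> s (d - j)%N N <= - e.
  rewrite subnn => -[e e0 [N0 /(_ N0 (leqnn _))]].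
  by have := hpos N0; lra.
elim=> [_|j IH jd].
  exists (- c); first by rewrite oppr_gt0.
  by exists 0%N => N _; rewrite subn0 hd opprK.
have [e e0 [N0 hN]] := IH (ltnW jd).
have step m : s (d - j.+1)%N (N0 + m)%N <= s (d - j.+1)%N N0 - m%:R * e.
  elim: m => [|m IHm]; first by rewrite addn0 mul0r subr0.
  rewrite addnS hs (subnSK jd) -natr1.
  have := hN (N0 + m)%N (leq_addr _ _); lra.
exists 1 => //; pose B := (`|s (d - j.+1)%N N0| + 1) / e.
exists (N0 + Num.bound B)%N => N hNN; rewrite -(subnKC (leq_trans (leq_addr _ _) hNN)).
apply: (le_trans (step _)).
have : B < (N - N0)%:R.
  apply: (@lt_le_trans _ _ (Num.bound B)%:R); last by rewrite ler_nat; lia.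
  by apply: archi_boundP; apply: divr_ge0; [rewrite addr_ge0|apply: ltW].
rewrite /B ltr_pdivrMr //; have := ler_norm (s (d - j.+1)%N N0); lra.
Qed.

Hypothesis n_gt0 : (0 < n)%N.

Lemma cdiff_is_linear K : linear (@cdiff R n K).
Proof.
move=> c p q; rewrite /cdiff scaler_sumr -big_split; apply: eq_bigr => i _ /=.
rewrite scaler_sumr -big_split; apply: eq_bigr => k _.
have -> l : dpart i l (c *: p + q) = c *: dpart i l p + dpart i l q.
  by rewrite /dpart; elim: l => //= l ->; rewrite linearP.
by rewrite scalerDr !scalerA [c * _]mulrC.
Qed.
HB.instance Definition _ K := GRing.isLinear.Build R M M _ (cdiff K) (cdiff_is_linear K).

Lemma cdiff_sub_lap K w p : dlt w p -> dlt (w - 4) (cdiff K.+1 p - lap p).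
Proof.
move=> hp; rewrite /cdiff /lap -sumrB; apply: dlt_sum => i _.
rewrite big_ord_recl /= divff ?pnatr_eq0 // scale1r addrC addKr.
apply: dlt_sum => k _; apply: dltZ.
by apply: (dlt_leq _ (dlt_dpart (k := (bump 0 k).+1.*2) hp)); rewrite /bump; lia.
Qed.

Lemma dlt_lap w p : dlt w p -> dlt (w - 2) (lap p).
Proof.
by move=> hp; apply: dlt_sum => i _; apply: (dlt_leq _ (dlt_dpart (k := 2) hp)).
Qed.

Lemma dlt_cdiff K w p : dlt w p -> dlt (w - 2) (cdiff K.+1 p).
Proof.
move=> hp; rewrite -[cdiff _ _](subrK (lap p)); apply: dltD; last exact: dlt_lap.
by apply: (dlt_leq _ (cdiff_sub_lap hp)); lia.
Qed.

Lemma iter_cdiff K w k p : dlt w p ->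
  dlt (w - k.*2) (iter k (cdiff K.+1) p) /\
  dlt (w - k.*2 - 2) (iter k (cdiff K.+1) p - lapn k p).
Proof.
move=> hp; elim: k => [|k [IH1 IH2]].
  by rewrite subn0 subrr; split => //; apply: dlt0.
split; first by apply: (dlt_leq _ (dlt_cdiff IH1)); lia.
rewrite iterS lapnS -[cdiff _ _](subrK (lap (iter k (cdiff K.+1) p))) -addrA -linearB.
apply: dltD; first by apply: (dlt_leq _ (cdiff_sub_lap IH1)); lia.
by apply: (dlt_leq _ (dlt_lap IH2)); lia.
Qed.

Lemma mevalf0 p : p.@[fun=> 0] = p@_0%MM.
Proof.
rewrite (mpolyE p) !raddf_sum /=; apply: eq_bigr => m _.
rewrite mevalZ mcoeffZ mevalX mcoeffX; congr (_ * _).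
have [->|/eqP m0] := eqVneq m 0%MM.
  by rewrite big1 // => i _; rewrite mnm0E expr0.
have /existsP[i mi] : [exists i, m i != 0%N].
  apply: contra_notT m0 => /existsPn h; apply/mnmP => i.
  by have := h i; rewrite mnm0E negbK => /eqP.
by rewrite (bigD1 i) //= expr0n (negbTE mi) mul0r.
Qed.

(* The simple random walk started at the origin: the mean of [h] after [N]
   steps is nonnegative, and its [d]-th finite difference in [N] is the constant
   [(2n)^-d * lapn d h]. *)
Lemma sph_ge0 d h : h \is (2 * d).-homog -> (forall x, 0 <= h.@[x]) -> 0 <= sph d h.
Proof.
move=> /dlt_homog hd hpos; apply: divr_ge0 => //.
pose c : R := (2 * n%:R)^-1.
have c_gt0 : 0 < c by rewrite invr_gt0 mulr_gt0 ?ltr0n.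
pose D p := c *: cdiff d.+1 p.
have Dlin : linear D by move=> a p q; rewrite /D linearP scalerDr !scalerA mulrC.
have DZ k p : iter k D p = c ^+ k *: iter k (cdiff d.+1) p.
  elim: k => [|k IH]; first by rewrite scale1r.
  by rewrite iterS IH /D linearZ scalerA -exprS.
pose A p := p + D p.
have Alin N p q : iter N A (p + q) = iter N A p + iter N A q.
  elim: N => //= N ->; rewrite /A.
  by have := Dlin 1 (iter N A p) (iter N A q); rewrite !scale1r => ->; rewrite addrACA.
have Adlt N p : dlt (2 * d).+1 p -> dlt (2 * d).+1 (iter N A p).
  elim: N => //= N IH /IH hN; apply: dltD => //; apply: dltZ.
  by apply: (dlt_leq _ (dlt_cdiff hN)); lia.
have Apos N : forall x, 0 <= (iter N A h).@[x].
  elim: N => //= N IH x; rewrite /A mevalD mevalZ meval_cdiff; last first.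
    by apply: (dlt_leq _ (Adlt N h hd)); lia.
  have E : (iter N A h).@[x] = c * \sum_(i < n) 2 * (iter N A h).@[x].
    by rewrite sumr_const card_ord -mulr_natr /c; field; rewrite pnatr_eq0 -lt0n.
  rewrite [X in X + _]E -mulrDr -big_split /= pmulr_rge0 //.
  by apply: sumr_ge0 => i _; rewrite addrC subrK addr_ge0.
have Bd : iter d.+1 D h = 0.
  rewrite DZ; have [h0 _] := iter_cdiff d d.+1 hd.
  by rewrite (dlt_eq0 (dlt_leq _ h0)) ?scaler0 //; lia.
have Bd' : iter d D h = c ^+ d *: lapn d h.
  rewrite DZ; have [_ h0] := iter_cdiff d d hd; congr (_ *: _).
  by apply/eqP; rewrite -subr_eq0; apply/eqP/dlt_eq0/(dlt_leq _ h0); lia.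
pose s k N := (iter N A (iter k D h)).@[fun=> 0].
suff : 0 <= (iter d D h).@[fun=> 0].
  by rewrite Bd' mevalZ pmulr_rge0 ?exprn_gt0 // mevalf0.
apply: (@diff_const_ge0 d _ s) => [k N|N|N].
- by rewrite /s iterSr {2}/A Alin mevalD iterS.
- suff -> : s d N = s d 0%N by [].
  elim: N => // N <-; rewrite /s iterSr {2}/A -iterS Bd addr0 //.
- exact: Apos.
Qed.
End Positivity.

Section MonomialBasis.
Variables (R : rcfType) (n m : nat).
Local Notation M := {mpoly R[n]}.
Implicit Types (p q g h : M).
Local Notation "d .-homog" := (@ishomog1 _ _ d (@mdeg n)) : ring_scope.

Definition mnm_deg := {b : 'X_{1..n < m.+1} | mdeg b == m}.
Definition hdim := #|{: mnm_deg}|.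
Definition mono (k : 'I_hdim) : 'X_{1..n} := val (val (enum_val k)).
Definition hpoly (v : 'rV[R]_hdim) : M := \sum_k v 0 k *: 'X_[mono k].
Definition hrow p : 'rV[R]_hdim := \row_k p@_(mono k).

Lemma mdeg_mono k : mdeg (mono k) = m.
Proof. exact/eqP/(valP (enum_val k)). Qed.

Lemma mono_inj : injective mono.
Proof. by move=> k l /val_inj/val_inj/enum_val_inj. Qed.

Lemma mono_surj b : mdeg b = m -> exists k, mono k = b.
Proof.
move=> bm; have lt_b : (mdeg b < m.+1)%N by rewrite bm.
have eq_b : mdeg (BMultinom lt_b) == m by apply/eqP.
by exists (enum_rank (Sub (BMultinom lt_b) eq_b : mnm_deg)); rewrite /mono enum_rankK.
Qed.

Lemma mcoeff_hpoly v k : (hpoly v)@_(mono k) = v 0 k.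
Proof.
rewrite /hpoly raddf_sum (bigD1 k) //= mcoeffZ mcoeffX eqxx mulr1 big1 ?addr0 //.
by move=> l /negbTE lk; rewrite mcoeffZ mcoeffX (inj_eq mono_inj) lk mulr0.
Qed.

Lemma hpolyK v : hrow (hpoly v) = v.
Proof. by apply/rowP => k; rewrite mxE mcoeff_hpoly. Qed.

Lemma hpoly_homog v : hpoly v \is m.-homog.
Proof.
by apply: rpred_sum => k _; apply: rpredZ; rewrite dhomogX; apply/eqP/mdeg_mono.
Qed.

Lemma hrowK p : p \is m.-homog -> hpoly (hrow p) = p.
Proof.
move=> hp; apply/mpolyP => b; have [/mono_surj [k <-]|bm] := eqVneq (mdeg b) m.
  by rewrite mcoeff_hpoly mxE.
have Z q : q \is m.-homog -> q@_b = 0.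
  by move=> /homogP hq; apply/eqP; apply: contraNT bm => /hq ->.
by rewrite !Z ?hpoly_homog.
Qed.

Lemma hpoly_is_linear : linear hpoly.
Proof.
move=> c v w; rewrite /hpoly scaler_sumr -big_split; apply: eq_bigr => k _ /=.
by rewrite !mxE scalerDl scalerA.
Qed.
HB.instance Definition _ := GRing.isLinear.Build R _ M _ hpoly hpoly_is_linear.

Lemma homog_inj_surj (f : {linear M -> M}) :
  (forall p, p \is m.-homog -> f p \is m.-homog) ->
  (forall p, p \is m.-homog -> f p = 0 -> p = 0) ->
  forall g, g \is m.-homog -> exists2 p, p \is m.-homog & f p = g.
Proof.
move=> fH finj g hg; pose A := \matrix_k hrow (f 'X_[mono k]).
have fE v : f (hpoly v) = hpoly (v *m A).
  rewrite {1}/hpoly mulmx_sum_row !linear_sum; apply: eq_bigr => k _ /=.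
  by rewrite !linearZ /= rowK hrowK // fH // dhomogX; apply/eqP/mdeg_mono.
have A_unit : A \in unitmx.
  rewrite -row_free_unit -kermx_eq0; apply/eqP/row_matrixP => k; rewrite row0.
  set v := row k _; have : f (hpoly v) = 0.
    by rewrite fE /v -row_mul mulmx_ker row0 linear0.
  by move/(finj _ (hpoly_homog v))/(congr1 hrow); rewrite hpolyK => ->;
    apply/rowP => l; rewrite !mxE mcoeff0.
exists (hpoly (hrow g *m invmx A)); first exact: hpoly_homog.
by rewrite fE mulmxKV // hrowK.
Qed.

Lemma hdim_le : (hdim <= m.+1 ^ n)%N.
Proof.
rewrite -[m.+1 in X in (_ <= X)%N]card_ord -[n in X in (_ <= X)%N]card_ord -card_ffun.
pose F (b : mnm_deg) : {ffun 'I_n -> 'I_m.+1} := [ffun i => inord (val (val b) i)].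
apply: (@leq_card _ _ F) => b c /ffunP eqF; apply/val_inj/val_inj/mnmP => i.
have lt_m (d : mnm_deg) : (val (val d) i < m.+1)%N.
  by rewrite ltnS -[X in (_ <= X)%N](eqP (valP d)) mdegE (bigD1 i) //= leq_addr.
by have := congr1 (@nat_of_ord _) (eqF i); rewrite !ffunE !inordK.
Qed.

End MonomialBasis.

Section InnerProduct.
Variables (R : archiRcfType) (n : nat).
Local Notation M := {mpoly R[n]}.
Implicit Types (p q f g h u v w : M).
Local Notation "d .-homog" := (@ishomog1 _ _ d (@mdeg n)) : ring_scope.
Local Notation rad2 := (@rad2 R n).
Hypothesis n_gt0 : (0 < n)%N.

Lemma sph_le m f g : f \is (2 * m).-homog -> g \is (2 * m).-homog ->
  (forall x, f.@[x] <= g.@[x]) -> sph m f <= sph m g.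
Proof.
move=> hf hg le_fg; rewrite -subr_ge0 -linearB sph_ge0 ?rpredB // => x.
by rewrite mevalB subr_ge0.
Qed.

Lemma sqr_homog m f g : f \is m.-homog -> g \is m.-homog -> f * g \is (2 * m).-homog.
Proof. by move=> hf hg; rewrite mul2n -addnn; apply: homogM. Qed.

Lemma sph_sqr_ge0 m f : f \is m.-homog -> 0 <= sph m (f * f).
Proof.
move=> hf; apply: sph_ge0 => // [|x]; first exact: sqr_homog.
by rewrite mevalM -expr2 sqr_ge0.
Qed.

Lemma sph_CS m f g : f \is m.-homog -> g \is m.-homog ->
  sph m (f * g) ^+ 2 <= sph m (f * f) * sph m (g * g).
Proof.
move=> hf hg; pose a := sph m (f * f); pose b := sph m (f * g); pose c := sph m (g * g).
have E s t : 0 <= s ^+ 2 * a + 2 * s * t * b + t ^+ 2 * c.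
  have : s *: f + t *: g \is m.-homog by rewrite rpredD // rpredZ.
  move/sph_sqr_ge0; rewrite (_ : _ * _ =
    (s ^+ 2) *: (f * f) + (2 * s * t) *: (f * g) + (t ^+ 2) *: (g * g)).
    by rewrite !linearD !linearZ.
  by rewrite -!mul_mpolyC ?rmorphM ?rmorphXn ?rmorph_nat; ring.
rewrite -/a -/b -/c; have a0 : 0 <= a by exact: sph_sqr_ge0.
have := sph_sqr_ge0 hg; rewrite -/c le_eqVlt => /predU1P[c0|c_gt0].
  rewrite -c0 mulr0; have [->|b0] := eqVneq b 0; first by rewrite expr0n.
  have := E 1 (- (a + 1) / (2 * b)); rewrite -c0 mulr0 addr0 expr1n mul1r mulr1.
  rewrite (_ : 2 * _ * b = - (a + 1)); last by field.
  by rewrite opprD addrA subrr add0r oppr_ge0 ler10.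
have := E c (- b).
rewrite (_ : _ + _ = c * (a * c - b ^+ 2)); last by ring.
by rewrite pmulr_rge0 // subr_ge0.
Qed.

(* The [L^2] norm on the unit sphere, for [f] homogeneous of degree [m]. *)
Definition nr m f := Num.sqrt (sph m (f * f)).

Lemma nr_ge0 m f : 0 <= nr m f. Proof. exact: sqrtr_ge0. Qed.

Lemma nr_sqr m f : f \is m.-homog -> nr m f ^+ 2 = sph m (f * f).
Proof. by move=> hf; rewrite sqr_sqrtr // sph_sqr_ge0. Qed.

Lemma sph_nr m f g : f \is m.-homog -> g \is m.-homog ->
  `|sph m (f * g)| <= nr m f * nr m g.
Proof.
move=> hf hg; rewrite -ler_sqr ?nnegrE ?mulr_ge0 ?nr_ge0 //.
by rewrite real_normK ?num_real // [leRHS]exprMn !nr_sqr // sph_CS.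
Qed.

Lemma sph_grad m g : g \is m.+1.-homog ->
  \sum_i sph m (g^`M(i) * g^`M(i)) + sph m (g * lap g) =
  ((2 * m + n) * m.+1)%:R * sph m.+1 (g * g).
Proof.
move=> hg; rewrite /lap mulr_sumr !linear_sum -big_split /=.
under eq_bigr => i _ do rewrite -linearD /= -mderivM sph_mderiv //.
rewrite -mulr_sumr -linear_sum /= natrM -mulrA; congr (_ * _).
have -> : \sum_i 'X_i * (g * g^`M(i)) = g * euler g.
  by rewrite /euler mulr_sumr; apply: eq_bigr => i _; ring.
by rewrite (euler_homog hg) mulrnAr linearMn mulr_natl.
Qed.

Lemma euler_eq0 m g : g \is m.+1.-homog -> (forall i, g^`M(i) = 0) -> g = 0.
Proof.
move=> hg hd; have := euler_homog hg; rewrite /euler big1 => [/eqP|i _]; last first.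
  by rewrite hd mulr0.
rewrite eq_sym -scaler_nat scaler_eq0 pnatr_eq0 /= => /eqP //.
Qed.

Lemma sph_sqr_eq0 m g : g \is m.-homog -> sph m (g * g) = 0 -> g = 0.
Proof.
elim: m g => [|m IH] g hg g0.
  have {1}-> : g = (g@_0%MM)%:MP.
    apply/mpolyP => b; rewrite mcoeffC; have [->|b0] := eqVneq b 0%MM; first by rewrite mulr1.
    rewrite mulr0; apply/eqP; apply: contraNT b0 => /(homogP _ _ hg) /eqP.
    by rewrite mdeg_eq0.
  move: g0; rewrite /sph /lapn /= divr1 mcoeff0M => /eqP; rewrite mulf_eq0 orbb => /eqP ->.
  by rewrite mpolyC0.
have hd i := mderiv_homog i hg.
have lap0 : sph m (g * lap g) = 0.
  apply/eqP; rewrite -normr_eq0 eq_le normr_ge0 andbT.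
  rewrite -(sph_rad2M n_gt0) mulrCA.
  case: m hg g0 {IH hd} => [|m] hg g0.
    by rewrite (lap_homog_lt2 _ hg) // !mulr0 linear0 normr0.
  have h2 : rad2 * lap g \is m.+2.-homog.
    by have := homogM (rad2_homog _ _) (lap_homog hg).
  by apply: le_trans (sph_nr hg h2) _; rewrite /nr g0 sqrtr0 mul0r.
apply: (euler_eq0 hg) => i; apply: IH => //=; apply/eqP.
have := sph_grad hg; rewrite g0 mulr0 lap0 addr0 => /eqP.
by rewrite psumr_eq0 => [/allP/(_ i)/=|j _]; [rewrite mem_index_enum; apply|exact: sph_sqr_ge0].
Qed.

Lemma nr_eq0 m g : g \is m.-homog -> nr m g = 0 -> g = 0.
Proof. by move=> hg g0; apply: (sph_sqr_eq0 hg); rewrite -nr_sqr // g0 expr0n. Qed.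

End InnerProduct.

(** * The Fischer operator *)

Section Fischer.
Variables (R : archiRcfType) (n : nat).
Local Notation M := {mpoly R[n]}.
Implicit Types (p q f g h u v w : M).
Local Notation "d .-homog" := (@ishomog1 _ _ d (@mdeg n)) : ring_scope.
Local Notation rad2 := (@rad2 R n).
Hypothesis n_gt0 : (0 < n)%N.

Definition rlap u : M := rad2 * lap u.

Lemma rlap_is_linear : linear rlap.
Proof. by move=> c u v; rewrite /rlap linearP mulrDr scalerAr. Qed.
HB.instance Definition _ := GRing.isLinear.Build R M M _ rlap rlap_is_linear.

Lemma rlap_homog m u : u \is m.-homog -> rlap u \is m.-homog.
Proof.
case: m => [|[|m]] hu; try by rewrite /rlap (lap_homog_lt2 _ hu) // mulr0 rpred0.
by have := homogM (rad2_homog R n) (lap_homog hu).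
Qed.

Lemma sph_mul_rlap m f u : f \is m.+1.-homog -> u \is m.+1.-homog ->
  sph m.+1 (f * rlap u) = sph m (f * lap u).
Proof. by move=> hf hu; rewrite /rlap mulrCA sph_rad2M. Qed.

Lemma sph_rlapC m f g : f \is m.-homog -> g \is m.-homog ->
  sph m (f * rlap g) = sph m (rlap f * g).
Proof.
case: m => [|m] hf hg.
  by rewrite /rlap (lap_homog_lt2 _ hf) // (lap_homog_lt2 _ hg) // !mulr0 mul0r.
rewrite sph_mul_rlap // mulrC [rlap f * g]mulrC sph_mul_rlap // mulrC.
by rewrite (sph_lapC n_gt0 m hf hg) mulrC.
Qed.

Definition rlapD (c : R) u : M := rlap u + c *: u.

Lemma rlapD_is_linear c : linear (rlapD c).
Proof.
by move=> a u v; rewrite /rlapD linearP scalerDr !scalerA mulrC -scalerA scalerDr addrACA.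
Qed.
HB.instance Definition _ c := GRing.isLinear.Build R M M _ (rlapD c) (rlapD_is_linear c).

Lemma rlapD_homog c m u : u \is m.-homog -> rlapD c u \is m.-homog.
Proof. by move=> hu; rewrite rpredD ?rlap_homog // rpredZ. Qed.

Lemma sph_mul_rlapD m c u v :
  sph m (v * rlapD c u) = sph m (v * rlap u) + c * sph m (v * u).
Proof. by rewrite /rlapD mulrDr -scalerAr linearD linearZ. Qed.

Lemma rlapD_surj_of m c : 0 < c ->
  (forall u, u \is m.-homog -> 0 <= sph m (u * rlap u)) ->
  forall g, g \is m.-homog ->
  exists2 u, u \is m.-homog & rlapD c u = g /\ c * nr m u <= nr m g.
Proof.
move=> c_gt0 pos; have B u : u \is m.-homog -> c * nr m u <= nr m (rlapD c u).
  move=> hu; have [->|nz] := eqVneq (nr m u) 0; first by rewrite mulr0 nr_ge0.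
  have u_gt0 : 0 < nr m u by rewrite lt_def nz nr_ge0.
  rewrite -(ler_pM2l u_gt0); apply: le_trans (ler_norm _) _.
  apply: le_trans (sph_nr n_gt0 hu (rlapD_homog c hu)).
  rewrite ger0_norm ?mulr_ge0 ?nr_ge0 ?(ltW c_gt0) //.
  apply: le_trans (ler_norm _); rewrite sph_mul_rlapD mulrCA -expr2 nr_sqr //.
  by rewrite lerDr pos.
move=> g hg; have [|u hu|u hu ug] := @homog_inj_surj R n m (rlapD c) _ _ g hg.
- by move=> u; apply: rlapD_homog.
- move=> u0; apply: (nr_eq0 n_gt0 hu); apply/eqP; have := B u hu; rewrite u0.
  by rewrite {2}/nr mul0r linear0 sqrtr0 pmulr_rle0 // => h; rewrite eq_le h nr_ge0.
- by exists u => //; split=> //; rewrite -ug B.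
Qed.

Lemma sph_rlap_ge0 m u : u \is m.-homog -> 0 <= sph m (u * rlap u).
Proof.
elim/ltn_ind: m u => -[|[|m]] IH u hu;
  try by rewrite /rlap (lap_homog_lt2 _ hu) // !mulr0 linear0.
pose c : R := (4 * m + 2 * n)%:R.
have c_gt0 : 0 < c by rewrite ltr0n; lia.
have [v hv [vE _]] := rlapD_surj_of c_gt0 (IH m (leqnSn _)) (lap_homog hu).
have rv : rad2 * v \is m.+2.-homog by apply: homogM (rad2_homog R n) hv.
have lapv : lap (rad2 * v) = lap u.
  by rewrite (lap_rad2M hv) -vE /rlapD /c scaler_nat.
have rE : rlap u = rad2 * rlapD c v by rewrite vE.
rewrite rE -[u in u * _](subrK (rad2 * v)) mulrDl linearD /=.
have -> : rad2 * rlapD c v = rlap (rad2 * v) by rewrite /rlap lapv -rE.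
rewrite (sph_rlapC (m := m.+2)) ?rpredB //.
rewrite {1}/rlap linearB /= lapv subrr mulr0 mul0r linear0 add0r.
rewrite /rlap lapv -vE -mulrA sph_rad2M // mulrCA sph_rad2M //.
rewrite sph_mul_rlapD addr_ge0 ?IH // mulr_ge0 ?(ltW c_gt0) //.
exact: sph_sqr_ge0.
Qed.

Lemma rlapD_surj m c g : 0 < c -> g \is m.-homog ->
  exists2 u, u \is m.-homog & rlapD c u = g /\ c * nr m u <= nr m g.
Proof. by move=> c_gt0; apply: rlapD_surj_of => // u; apply: sph_rlap_ge0. Qed.

Lemma lapn_rad2n_surj k m g : g \is m.-homog ->
  exists2 u, u \is m.-homog &
    lapn k (rad2 ^+ k * u) = g /\ m.+1%:R ^+ k * nr m u <= nr m g.
Proof.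
elim: k g => [|k IH] g hg; first by exists g; rewrite ?mul1r.
have [v hv [vg vn]] := IH g hg.
pose c : R := (2 * k.+1 * (2 * m + 2 * k + n))%:R.
have c_ge : m.+1%:R <= c by rewrite ler_nat; nia.
have [|u hu [uv un]] := @rlapD_surj m c v _ hv; first by apply: lt_le_trans c_ge.
exists u => //; split.
  rewrite lapnSr (lap_rad2nM _ hu) -vg -uv /rlapD /c scaler_nat /rlap.
  by rewrite exprSr -mulrA -mulrnAr -mulrDr.
apply: le_trans vn; rewrite exprSr -mulrA ler_wpM2l ?exprn_ge0 //.
by apply: le_trans un; rewrite ler_wpM2r ?nr_ge0.
Qed.

Definition rlapn k w : M := rad2 ^+ k * lapn k w.

Lemma rlapn_homog k m w : w \is m.-homog -> rlapn k w \is m.-homog.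
Proof.
move=> hw; have [hk|hk] := leqP k.*2 m; last first.
  by rewrite /rlapn (lapn_homog_eq0 hk hw) mulr0 rpred0.
by have := rad2M_homog k (lapn_homog k hw); rewrite subnKC.
Qed.

Lemma rlapnS k m w : w \is m.-homog -> exists c : R, forall v, v \is m.-homog ->
  rlapn k.+1 v = rlap (rlapn k v) - c *: rlapn k v.
Proof.
move=> hw; case: k => [|k].
  by exists 0 => v _; rewrite scale0r subr0 /rlapn expr1 !mul1r.
exists (2 * k.+1 * (2 * (m - k.+1.*2) + 2 * k + n))%:R => v hv.
rewrite /rlapn /rlap (lap_rad2nM _ (lapn_homog k.+1 hv)) mulrDr !scaler_nat.
by rewrite mulrnAr !mulrA -!exprS addrK.
Qed.

Lemma rlapn_rlap k m w : w \is m.-homog -> rlapn k (rlap w) = rlap (rlapn k w).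
Proof.
move=> hw; elim: k => [|k IH]; first by rewrite /rlapn !mul1r.
have [c cE] := rlapnS k hw.
by rewrite !cE ?rlap_homog // IH [in RHS]linearB [in RHS]linearZ.
Qed.

Lemma sph_rlapnC k m w v : w \is m.-homog -> v \is m.-homog ->
  sph m (w * rlapn k v) = sph m (rlapn k w * v).
Proof.
move=> hw hv; elim: k w hw => [|k IH] w hw; first by rewrite /rlapn !mul1r.
have [c cE] := rlapnS k hw; rewrite !cE // mulrBr mulrBl -scalerAr -scalerAl.
rewrite !linearB !linearZ /= IH // sph_rlapC ?rlapn_homog //.
by rewrite IH ?rlap_homog // (rlapn_rlap _ hw).
Qed.

Lemma sph_lapnC k m w g : w \is (k.*2 + m).-homog -> g \is m.-homog ->
  sph m (lapn k w * g) = sph (k + m) (w * lapn k (rad2 ^+ k * g)).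
Proof.
move=> hw hg; rewrite -(sph_rad2nM n_gt0 k.*2) -addnn exprD.
rewrite (_ : rad2 ^+ k * rad2 ^+ k * (lapn k w * g) = rlapn k w * (rad2 ^+ k * g));
  last by rewrite /rlapn; ring.
rewrite addnn -sph_rlapnC // ?rad2M_homog // /rlapn mulrCA -addnn -addnA.
by rewrite sph_rad2nM.
Qed.

Section FischerOperator.
Variables (k : nat) (P : M) (delta : R).
Hypotheses (P_homog : P \is (2 * k).-homog) (delta_gt0 : 0 < delta).
Hypothesis P_ge : forall x, delta * (rad2 ^+ k).@[x] <= P.@[x].

Lemma fischer_homog m q : q \is m.-homog -> lapn k (P * q) \is m.-homog.
Proof. by move=> hq; have := lapn_homog k (homogM P_homog hq); rewrite -mul2n addKn. Qed.

(* Testing [lapn k (P q)] against the solution [g] of [lapn k (rad2 ^+ k * g) = q]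
   gives the mean of [P q^2] over the sphere. *)
Lemma fischer_bound m q : q \is m.-homog ->
  delta * m.+1%:R ^+ k * nr m q <= nr m (lapn k (P * q)).
Proof.
move=> hq; have [g hg [gq gn]] := lapn_rad2n_surj k hq.
have hPq : P * q \is (k.*2 + m).-homog by rewrite -mul2n; apply: homogM.
have hf := fischer_homog hq.
have E : delta * nr m q ^+ 2 <= nr m (lapn k (P * q)) * nr m g.
  apply: le_trans (sph_nr n_gt0 hf hg); apply: le_trans (ler_norm _).
  rewrite (sph_lapnC hPq hg) gq nr_sqr // -(sph_rad2nM n_gt0 k) -linearZ /=.
  rewrite scalerAl -mulrA; have hh : q * q \is (2 * m).-homog by apply: sqr_homog.
  apply: sph_le => //; first by rewrite mulnDr; apply/homogM/hh/rpredZ;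
    rewrite mul2n rad2n_homog.
    by rewrite mulnDr; apply: homogM.
  by move=> x; rewrite !mevalM mevalZ ler_wpM2r // -expr2 sqr_ge0.
have [->|nz] := eqVneq (nr m q) 0; first by rewrite mulr0 nr_ge0.
have q_gt0 : 0 < nr m q by rewrite lt_def nz nr_ge0.
rewrite -(ler_pM2r q_gt0); apply: le_trans (ler_wpM2l (nr_ge0 _ _) gn).
rewrite [leRHS]mulrCA [leLHS](_ : _ = m.+1%:R ^+ k * (delta * nr m q ^+ 2)).
  by rewrite ler_wpM2l // exprn_ge0.
by ring.
Qed.

Lemma fischer_inj m q : q \is m.-homog -> lapn k (P * q) = 0 -> q = 0.
Proof.
move=> hq h0; have := fischer_bound hq; rewrite h0 {2}/nr mul0r linear0 sqrtr0.
rewrite pmulr_rle0 ?mulr_gt0 ?exprn_gt0 ?ltr0n // => h.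
by apply: (nr_eq0 n_gt0 hq); apply/eqP; rewrite eq_le h nr_ge0.
Qed.

Definition fischer q : M := lapn k (P * q).

Lemma fischer_is_linear : linear fischer.
Proof. by move=> c p q; rewrite /fischer mulrDr -scalerAr linearP. Qed.
HB.instance Definition _ := GRing.isLinear.Build R M M _ fischer fischer_is_linear.

Lemma fischer_surj m f : f \is m.-homog ->
  exists2 q, q \is m.-homog & lapn k (P * q) = f.
Proof.
apply: (@homog_inj_surj R n m fischer) => q; first exact: fischer_homog.
exact: fischer_inj.
Qed.

End FischerOperator.

Lemma nr_mderiv m i g : g \is m.+1.-homog ->
  nr m g^`M(i) <= ((n.+2) * m.+1)%:R * nr m.+1 g.
Proof.
move=> hg; rewrite -ler_sqr ?nnegrE ?mulr_ge0 ?nr_ge0 //.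
have hd j := mderiv_homog j hg.
rewrite exprMn !nr_sqr //; apply: (@le_trans _ _ (((2 * m + n) * m.+1)%:R * sph m.+1 (g * g))).
  rewrite -(sph_grad n_gt0 hg) (bigD1 i) //= -addrA lerDl addr_ge0 //.
    by apply: sumr_ge0 => j _; apply: sph_sqr_ge0 (hd j).
  by rewrite -sph_mul_rlap // sph_rlap_ge0.
by rewrite ler_wpM2r ?sph_sqr_ge0 // -natrX ler_nat; nia.
Qed.

End Fischer.

(** * Pointwise bounds from the reproducing kernel *)

Section Kernel.
Variables (R : archiRcfType) (n : nat).
Local Notation M := {mpoly R[n]}.
Implicit Types (p q f g h u v w : M) (i j : 'I_n).
Local Notation "d .-homog" := (@ishomog1 _ _ d (@mdeg n)) : ring_scope.
Local Notation rad2 := (@rad2 R n).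
Hypothesis n_gt0 : (0 < n)%N.

(* The infinitesimal rotation in the plane [(x_i, x_j)]. *)
Definition rot i j u : M := 'X_i * u^`M(j) - 'X_j * u^`M(i).

Lemma rot_is_linear i j : linear (rot i j).
Proof. by move=> c u v; rewrite /rot !linearP /= -!mul_mpolyC; ring. Qed.
HB.instance Definition _ i j := GRing.isLinear.Build R M M _ (rot i j) (rot_is_linear i j).

Lemma rotM i j u v : rot i j (u * v) = rot i j u * v + u * rot i j v.
Proof. by rewrite /rot !mderivM; ring. Qed.

Lemma rot_homog i j m u : u \is m.-homog -> rot i j u \is m.-homog.
Proof.
case: m => [|m] hu; first by rewrite /rot !(mderiv_homog0 _ hu) !mulr0 subr0 rpred0.
by rewrite rpredB // -add1n; apply: homogM; rewrite ?homogX //; apply: (mderiv_homog _ hu).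
Qed.

Lemma sph_rot d i j u : sph d (rot i j u) = 0.
Proof.
rewrite /rot linearB /=; case: d => [|d].
  by rewrite /sph /lapn /= !mcoeff0M !mcoeffX !mnm1_eq0 !mul0r subrr.
have hn : (2 * d + n)%:R != 0 :> R by apply: natr_neq0; lia.
by apply: (mulfI hn); rewrite mulr0 mulrBr -!sph_mderiv // mderiv_comm subrr.
Qed.

Lemma lap_rot i j u : lap (rot i j u) = rot i j (lap u).
Proof.
rewrite /rot linearB /= !lap_mulX !mderiv_lap mderiv_comm.
by rewrite opprD addrACA subrr addr0.
Qed.

Lemma rot_eq0_rad2n m u : u \is (2 * m).-homog -> (forall i j, rot i j u = 0) ->
  u = sph m u *: rad2 ^+ m.
Proof.
elim: m u => [|m IH] u hu rot0.
  rewrite expr0 -mul_mpolyC mulr1; apply/mpolyP => b; rewrite mcoeffC /sph /lapn /= divr1.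
  have [->|b0] := eqVneq b 0%MM; first by rewrite mulr1.
  rewrite mulr0; apply/eqP; apply: contraNT b0 => /(homogP _ _ hu) /eqP.
  by rewrite mdeg_eq0.
have rd j : rad2 * u^`M(j) = 'X_j * (u *+ (2 * m.+1)).
  rewrite -(euler_homog hu); apply/eqP; rewrite -subr_eq0; apply/eqP.
  transitivity (\sum_i 'X_i * rot i j u); last by apply: big1 => i _; rewrite rot0 mulr0.
  by rewrite /euler mulr_suml mulr_sumr -sumrB; apply: eq_bigr => i _; rewrite /rot; ring.
have hl : lap u \is (2 * m).-homog.
  by have := lap_homog hu; rewrite mulnS.
have lE := IH (lap u) hl (fun i j => etrans (esym (lap_rot i j u)) (etrans (congr1 _
  (rot0 i j)) (linear0 _))).
have key : rad2 * lap u = u *+ (2 * m.+1 * (n + 2 * m)).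
  have : \sum_j (rad2 * u^`M(j))^`M(j) = \sum_j ('X_j * (u *+ (2 * m.+1)))^`M(j).
    by apply: eq_bigr => j _; rewrite rd.
  rewrite (eq_bigr (fun j => ('X_j * u^`M(j)) *+ 2 + rad2 * u^`M(j)^`M(j))); last first.
    move=> j _; rewrite mderivM; congr (_ + _).
    rewrite /rad2 linear_sum /= (bigD1 j) //= big1 ?addr0 => [|i /negbTE ij].
      by rewrite expr2 mderivM mderivXU eqxx mulr1n; ring.
    by rewrite expr2 mderivM mderivXU ij mulr0n mul0r mulr0 addr0.
  have -> : \sum_j ('X_j * (u *+ (2 * m.+1)))^`M(j) =
      \sum_j (u *+ (2 * m.+1) + ('X_j * u^`M(j)) *+ (2 * m.+1)).
    by apply: eq_bigr => j _; rewrite mderivM mderivXU eqxx mul1r linearMn mulrnAr.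
  rewrite !big_split /= !sumrMnl -mulr_sumr -/(lap u) sumr_const card_ord.
  rewrite -/(euler u) (euler_homog hu) -!mulrnA -!mulrnDr => h.
  apply: (addrI (u *+ (2 * m.+1 + 2 * m.+1))); rewrite h -mulrnDr.
  by congr (_ *+ _); lia.
have hK : (2 * m.+1 * (n + 2 * m))%:R != 0 :> R by apply: natr_neq0; rewrite muln_gt0; lia.
have {key} uE : u = (sph m (lap u) / (2 * m.+1 * (n + 2 * m))%:R) *: rad2 ^+ m.+1.
  apply: (scalerI hK); rewrite scaler_nat -key scalerA mulrCA divff // mulr1.
  by rewrite exprS scalerAr -lE.
by rewrite [in RHS]uE linearZ /= sph_rad2n // mulr1.
Qed.

Section Gram.
Variable m : nat.
Local Notation N := (hdim n m).
Local Notation e k := ('X_[mono k] : M).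

Definition gram : 'M[R]_N := \matrix_(k, l) sph m (e k * e l).

Lemma homog_mono (k : 'I_N) : e k \is m.-homog.
Proof. by rewrite dhomogX; apply/eqP/mdeg_mono. Qed.

Lemma sph_hpoly (v w : 'rV[R]_N) :
  sph m (hpoly v * hpoly w) = (v *m gram *m w^T) 0 0.
Proof.
rewrite /hpoly mulr_suml linear_sum mxE /=.
under [RHS]eq_bigr => l _ do rewrite !mxE mulr_suml.
rewrite [RHS]exchange_big; apply: eq_bigr => k _ /=.
rewrite mulr_sumr linear_sum; apply: eq_bigr => l _ /=.
by rewrite mxE -scalerAl -scalerAr !linearZ /=; ring.
Qed.

Lemma gram_sym : gram^T = gram.
Proof. by apply/matrixP => k l; rewrite !mxE mulrC. Qed.

Lemma gram_unit : gram \in unitmx.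
Proof.
rewrite -row_free_unit -kermx_eq0; apply/eqP/row_matrixP => k; rewrite row0.
set v := row k _; have v0 : v *m gram = 0 by rewrite /v -row_mul mulmx_ker row0.
have := sph_hpoly v v; rewrite v0 mul0mx mxE.
move/(sph_sqr_eq0 n_gt0 (hpoly_homog v))/(congr1 (@hrow R n m)); rewrite hpolyK => ->.
by apply/rowP => l; rewrite !mxE mcoeff0.
Qed.

Lemma invgram_sym : (invmx gram)^T = invmx gram.
Proof. by rewrite trmx_inv gram_sym. Qed.

Definition quad (B : 'M[R]_N) : M := \sum_k \sum_l B k l *: (e k * e l).

Lemma quadD B C : quad (B + C) = quad B + quad C.
Proof.
rewrite /quad -big_split; apply: eq_bigr => k _; rewrite -big_split.
by apply: eq_bigr => l _ /=; rewrite mxE scalerDl.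
Qed.

Definition rotmx i j : 'M[R]_N := \matrix_k hrow m (rot i j (e k)).

Lemma rot_mono i j (k : 'I_N) : rot i j (e k) = \sum_l rotmx i j k l *: e l.
Proof.
rewrite -[LHS](hrowK (rot_homog i j (homog_mono k))) /hpoly.
by apply: eq_bigr => l _; rewrite !mxE.
Qed.

Lemma rot_quad i j B :
  rot i j (quad B) = quad ((rotmx i j)^T *m B + B *m rotmx i j).
Proof.
rewrite quadD /quad linear_sum /=; under eq_bigr do rewrite linear_sum /=.
under eq_bigr => k _ do under eq_bigr => l _ do
  rewrite linearZ /= rotM scalerDr !rot_mono mulr_suml mulr_sumr !scaler_sumr.
under eq_bigr do rewrite big_split /=.
rewrite big_split /=; congr (_ + _).
  under eq_bigr do rewrite exchange_big /=.
  rewrite exchange_big /=; apply: eq_bigr => k _; rewrite exchange_big /=.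
  apply: eq_bigr => l _; rewrite mxE scaler_suml; apply: eq_bigr => s _.
  by rewrite [_^T _ _]mxE -scalerAl scalerA mulrC.
apply: eq_bigr => k _; rewrite exchange_big /=; apply: eq_bigr => l _ /=.
rewrite mxE scaler_suml; apply: eq_bigr => s _.
by rewrite -scalerAr scalerA.
Qed.

Lemma rotmx_skew i j : rotmx i j *m gram + gram *m (rotmx i j)^T = 0.
Proof.
apply/matrixP => k l; rewrite !mxE -[RHS](sph_rot m i j (e k * e l)) rotM linearD /=.
rewrite !rot_mono mulr_suml mulr_sumr !linear_sum /=.
by congr (_ + _); apply: eq_bigr => s _; rewrite !mxE -?scalerAl -?scalerAr linearZ //= mulrC.
Qed.

(* [quad (invmx gram)] is the reproducing kernel of the homogeneous polynomials
   of degree [m] restricted to the diagonal; rotation invariance makes it constant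
   on spheres, and its mean is the dimension. *)
Lemma quad_invgram : quad (invmx gram) = N%:R *: rad2 ^+ m.
Proof.
have hq B : quad B \is (2 * m).-homog.
  by apply: rpred_sum => k _; apply: rpred_sum => l _;
    apply: rpredZ; apply: sqr_homog (homog_mono k) (homog_mono l).
rewrite (rot_eq0_rad2n (hq _)); last first.
  move=> i j; rewrite rot_quad (_ : _ + _ = 0).
    by rewrite /quad big1 // => k _; rewrite big1 // => l _; rewrite mxE scale0r.
  have := congr1 (fun B => invmx gram *m B *m invmx gram) (rotmx_skew i j).
  rewrite mulmx0 mul0mx mulmxDr mulmxDl !mulmxA (mulVmx gram_unit) mul1mx.
  by rewrite -2!mulmxA (mulmxV gram_unit) mulmx1 addrC.
congr (_ *: _); rewrite /quad linear_sum /=.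
transitivity (\tr (invmx gram *m gram)); last by rewrite mulVmx ?gram_unit // mxtrace1.
apply: eq_bigr => k _; rewrite linear_sum mxE /=; apply: eq_bigr => l _.
by rewrite linearZ /= mxE [e l * _]mulrC.
Qed.

Lemma meval_le_nr g x : g \is m.-homog ->
  g.@[x] ^+ 2 <= N%:R * nr m g ^+ 2 * rad2.@[x] ^+ m.
Proof.
move=> hg; pose y : 'rV[R]_N := \row_k (e k).@[x]; pose W := invmx gram.
have := sph_CS n_gt0 hg (hpoly_homog (y *m W)).
rewrite nr_sqr // -[in sph m (g * hpoly _)](hrowK hg) !sph_hpoly !trmx_mul invgram_sym.
rewrite -!mulmxA (mulmxA gram) (mulmxV gram_unit) mul1mx mulmxA.
have -> : (hrow m g *m y^T) 0 0 = g.@[x].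
  rewrite -[in RHS](hrowK hg) /hpoly linear_sum mxE; apply: eq_bigr => k _ /=.
  by rewrite mevalZ !mxE.
have -> : (y *m W *m y^T) 0 0 = (quad W).@[x].
  rewrite /quad linear_sum mxE /=.
  under eq_bigr => l _ do rewrite mxE mulr_suml.
  rewrite exchange_big; apply: eq_bigr => k _ /=.
  rewrite linear_sum; apply: eq_bigr => l _ /=.
  by rewrite mevalZ mevalM !mxE; ring.
by rewrite quad_invgram mevalZ rmorphXn /= => h; rewrite mulrAC [leRHS]mulrC.
Qed.

End Gram.
End Kernel.

(** * Homogeneous series *)

Section Absorb.
Variable R : rcfType.

Lemma geom_sum_le (t : R) N : 0 <= t < 1 -> \sum_(i < N) t ^+ i <= (1 - t)^-1.
Proof.
move=> /andP[t0 t1]; have d0 : 0 < 1 - t by rewrite subr_gt0.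
rewrite -[leRHS]mul1r ler_pdivlMr // mulrC.
have -> : (1 - t) * \sum_(i < N) t ^+ i = 1 - t ^+ N.
  by rewrite -[in RHS](expr1n R N) subrXX; congr (_ * _); apply: eq_bigr => i _;
    rewrite expr1n mul1r.
by rewrite gerBl exprn_ge0.
Qed.

Lemma poly_geom_bound k (t : R) : 0 <= t < 1 ->
  exists2 C : R, 0 <= C & forall m, m.+1%:R ^+ k * t ^+ m <= C.
Proof.
elim: k t => [|k IH] t /andP[t0 t1].
  by exists 1 => // m; rewrite mul1r exprn_ile1 // ltW.
have s01 : 0 <= Num.sqrt t < 1.
  by rewrite sqrtr_ge0 -sqrtr1 ltr_sqrt.
have [C C0 hC] := IH _ s01; have /andP[s0 s1] := s01.
exists (C * (1 - Num.sqrt t)^-1) => [|m].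
  by rewrite mulr_ge0 // invr_ge0 subr_ge0 ltW.
rewrite -{1}(sqr_sqrtr t0) exprSr -exprM mulnC exprM expr2 mulrACA.
apply: ler_pM => //; rewrite ?mulr_ge0 ?exprn_ge0 //.
apply: le_trans (geom_sum_le m.+1 s01).
rewrite mulr_natl -[m.+1 in leLHS]card_ord -sumr_const ler_sum // => i _.
by rewrite ler_wiXn2l // ?ltW // -ltnS.
Qed.

End Absorb.

Section Norms.
Variables (R : archiRcfType) (n : nat).
Local Notation M := {mpoly R[n]}.
Implicit Types (p q f g h : M).
Local Notation "d .-homog" := (@ishomog1 _ _ d (@mdeg n)) : ring_scope.
Local Notation rad2 := (@rad2 R n).
Hypothesis n_gt0 : (0 < n)%N.

Lemma meval_rad2 (x : 'I_n -> R) : rad2.@[x] = \sum_i x i ^+ 2.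
Proof. by rewrite linear_sum; apply: eq_bigr => i _ /=; rewrite rmorphXn /= mevalXU. Qed.

Lemma meval_rad2_ge0 (x : 'I_n -> R) : 0 <= rad2.@[x].
Proof. by rewrite meval_rad2 sumr_ge0 // => i _; rewrite sqr_ge0. Qed.

Lemma nr_le_sup m f (A : R) : f \is m.-homog -> 0 <= A ->
  (forall x, f.@[x] ^+ 2 <= A ^+ 2 * rad2.@[x] ^+ m) -> nr m f <= A.
Proof.
move=> hf A0 h; rewrite -ler_sqr ?nnegrE ?nr_ge0 // nr_sqr //.
have -> : A ^+ 2 = sph m (A ^+ 2 *: rad2 ^+ m) by rewrite linearZ /= sph_rad2n // mulr1.
apply: sph_le => // [||x]; first exact: sqr_homog.
  by rewrite rpredZ // mul2n rad2n_homog.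
by rewrite mevalM mevalZ rmorphXn -expr2.
Qed.

Lemma nrZ m c f : nr m (c *: f) = `|c| * nr m f.
Proof.
rewrite /nr -scalerAl -scalerAr scalerA linearZ /= -expr2.
by rewrite sqrtrM ?sqr_ge0 // sqrtr_sqr.
Qed.

Lemma nrN m f : nr m (- f) = nr m f.
Proof. by rewrite -scaleN1r nrZ normrN1 mul1r. Qed.

Lemma nr0 m : nr m (0 : M) = 0.
Proof. by rewrite -(scale0r 0) nrZ normr0 mul0r. Qed.

Lemma nrD m f g : f \is m.-homog -> g \is m.-homog -> nr m (f + g) <= nr m f + nr m g.
Proof.
move=> hf hg; rewrite -ler_sqr ?nnegrE ?addr_ge0 ?nr_ge0 // nr_sqr ?rpredD //.
rewrite (_ : (f + g) * (f + g) = f * f + (f * g) *+ 2 + g * g); last by ring.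
rewrite !linearD /= -!nr_sqr // sqrrD mulr2n.
have := le_trans (ler_norm _) (sph_nr n_gt0 hf hg); lra.
Qed.

Lemma hdim_natr_le m : (hdim n m)%:R <= (m.+1%:R ^+ n) ^+ 2 :> R.
Proof.
rewrite -!natrX ler_nat; apply: leq_trans (hdim_le n m) _.
by rewrite -{1}[(_ ^ n)%N]expn1 leq_pexp2l // expn_gt0.
Qed.

Lemma meval_sqr_le m f x : f \is m.-homog ->
  f.@[x] ^+ 2 <= (m.+1%:R ^+ n * nr m f) ^+ 2 * rad2.@[x] ^+ m.
Proof.
move=> hf; apply: le_trans (meval_le_nr n_gt0 x hf) _.
rewrite exprMn; apply: ler_wpM2r; first by rewrite exprn_ge0 ?meval_rad2_ge0.
by apply: ler_wpM2r; rewrite ?sqr_ge0 // hdim_natr_le.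
Qed.

Lemma meval_norm_le m f x : f \is m.-homog ->
  `|f.@[x]| <= m.+1%:R ^+ n * nr m f * Num.sqrt rad2.@[x] ^+ m.
Proof.
move=> hf; rewrite -ler_sqr ?nnegrE // ?mulr_ge0 ?exprn_ge0 ?nr_ge0 ?sqrtr_ge0 //.
rewrite real_normK ?num_real //; apply: le_trans (meval_sqr_le x hf) _.
by rewrite [leRHS]exprMn -exprM mulnC exprM sqr_sqrtr // meval_rad2_ge0.
Qed.

Lemma nrM i j f g : f \is i.-homog -> g \is j.-homog ->
  nr (i + j) (f * g) <= i.+1%:R ^+ n * nr i f * nr j g.
Proof.
move=> hf hg; set B := _ ^+ n * _; have B0 : 0 <= B by rewrite mulr_ge0 ?exprn_ge0 ?nr_ge0.
have hfg : f * g \is (i + j).-homog by apply: homogM.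
rewrite -ler_sqr ?nnegrE; last 2 first; [exact: nr_ge0|by apply: mulr_ge0 (nr_ge0 _ _)|].
rewrite [leRHS]exprMn (nr_sqr n_gt0 hfg)
  (nr_sqr n_gt0 hg) -[sph j _](sph_rad2nM n_gt0 i) -linearZ /= scalerAl.
have hg2 := sqr_homog hg hg.
apply: sph_le => // [||x].
- by apply: sqr_homog; apply: homogM.
- by rewrite mulnDr; apply: homogM => //; rewrite rpredZ // mul2n rad2n_homog.
rewrite !mevalM mevalZ rmorphXn /= mulrACA -!expr2.
by apply: ler_wpM2r; [rewrite sqr_ge0|apply: meval_sqr_le].
Qed.

Local Notation U := (M * M)%type.
Implicit Types (a u v w : U).

(* A pair of real polynomials stands for the complex polynomial [u.1 + i u.2]. *)
Definition hom m u := (u.1 \is m.-homog) && (u.2 \is m.-homog).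
Definition pnr m u : R := nr m u.1 + nr m u.2.
Definition cmul u v : U := (u.1 * v.1 - u.2 * v.2, u.1 * v.2 + u.2 * v.1).
Definition pderiv i u : U := (u.1^`M(i), u.2^`M(i)).

Lemma hom0 m : hom m 0. Proof. by rewrite /hom !rpred0. Qed.
Lemma homD m u v : hom m u -> hom m v -> hom m (u + v).
Proof. by move=> /andP[? ?] /andP[? ?]; rewrite /hom !rpredD. Qed.
Lemma homB m u v : hom m u -> hom m v -> hom m (u - v).
Proof. by move=> /andP[? ?] /andP[? ?]; rewrite /hom !rpredB. Qed.
Lemma hom_sum m (I : Type) (r : seq I) (Q : pred I) (F : I -> U) :
  (forall i, Q i -> hom m (F i)) -> hom m (\sum_(i <- r | Q i) F i).
Proof. by move=> h; apply: (big_ind (hom m)) => //; [exact: hom0|exact: homD]. Qed.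
Lemma hom_cmul i j u v : hom i u -> hom j v -> hom (i + j) (cmul u v).
Proof.
by move=> /andP[? ?] /andP[? ?]; rewrite /hom /= rpredB ?rpredD //; apply: homogM.
Qed.
Lemma hom_pderiv m i u : hom m.+1 u -> hom m (pderiv i u).
Proof.
by move=> /andP[h1 h2]; rewrite /hom (mderiv_homog i h1) (mderiv_homog i h2).
Qed.

Lemma pnr_ge0 m u : 0 <= pnr m u. Proof. by rewrite addr_ge0 ?nr_ge0. Qed.
Lemma pnr0 m : pnr m 0 = 0. Proof. by rewrite /pnr !nr0 addr0. Qed.
Lemma pnrN m u : pnr m (- u) = pnr m u. Proof. by rewrite /pnr !nrN. Qed.

Lemma pnrD m u v : hom m u -> hom m v -> pnr m (u + v) <= pnr m u + pnr m v.
Proof.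
by move=> /andP[? ?] /andP[? ?]; rewrite /pnr [leRHS]addrACA lerD // nrD.
Qed.

Lemma pnrB m u v : hom m u -> hom m v -> pnr m (u - v) <= pnr m u + pnr m v.
Proof.
move=> hu hv; rewrite -[pnr m v]pnrN pnrD //.
by move: hv; rewrite /hom !rpredN.
Qed.

Lemma pnr_sum m (I : Type) (r : seq I) (Q : pred I) (F : I -> U) :
  (forall i, Q i -> hom m (F i)) ->
  pnr m (\sum_(i <- r | Q i) F i) <= \sum_(i <- r | Q i) pnr m (F i).
Proof.
move=> h; suff : hom m (\sum_(i <- r | Q i) F i) /\
  pnr m (\sum_(i <- r | Q i) F i) <= \sum_(i <- r | Q i) pnr m (F i) by case.
apply: (big_ind2 (fun u b => hom m u /\ pnr m u <= b)) => [|u b v c [hu ub] [hv vc]|i /h hi //].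
  by rewrite hom0 pnr0.
by split; [exact: homD|apply: le_trans (pnrD hu hv) _; rewrite lerD].
Qed.

Lemma pnr_eq0 m u : hom m u -> pnr m u = 0 -> u = 0.
Proof.
case: u => u1 u2 /andP[h1 h2] /eqP; rewrite paddr_eq0 ?nr_ge0 // => /andP[/eqP e1 /eqP e2].
by congr (_, _); [apply: nr_eq0 h1 e1|apply: nr_eq0 h2 e2].
Qed.

Lemma pnr_cmul i j u v : hom i u -> hom j v ->
  pnr (i + j) (cmul u v) <= i.+1%:R ^+ n * pnr i u * pnr j v.
Proof.
move=> /andP[u1 u2] /andP[v1 v2]; rewrite /pnr /=.
have h1 := nrM u1 v1; have h2 := nrM u2 v2; have h3 := nrM u1 v2; have h4 := nrM u2 v1.
have := nrD (homogM u1 v2) (homogM u2 v1).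
have := @nrD _ (u.1 * v.1) (- (u.2 * v.2)) (homogM u1 v1).
rewrite nrN rpredN => /(_ (homogM u2 v2)).
move: h1 h2 h3 h4; rewrite !mulrDr !mulrDl; lra.
Qed.

Lemma pnr_pderiv m i u : hom m.+1 u ->
  pnr m (pderiv i u) <= (n.+2 * m.+1)%:R * pnr m.+1 u.
Proof.
by move=> /andP[u1 u2]; rewrite /pnr mulrDr lerD // nr_mderiv.
Qed.

Local Notation US := (nat -> U).

Definition homs (u : US) := forall m, hom m (u m).
(* The homogeneous series [\sum_m u_m] converges normally on compact subsets of
   the ball of radius [r]. *)
Definition summ (r : R) (u : US) := homs u /\
  forall s, 0 < s < r -> exists2 F : R, 0 <= F & forall m, pnr m (u m) * s ^+ m <= F.

Definition seqd i (u : US) : US := fun m => pderiv i (u m.+1).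
Definition seqmul (a u : US) : US := fun m => \sum_(i < m.+1) cmul (a i) (u (m - i)%N).

Lemma homs_seqd i (u : US) : homs u -> homs (seqd i u).
Proof. by move=> h m; apply/hom_pderiv/h. Qed.

Lemma homs_seqmul (a u : US) : homs a -> homs u -> homs (seqmul a u).
Proof.
move=> ha hu m; apply: hom_sum => i _.
by rewrite -[X in hom X _](subnKC (leq_ord i)) hom_cmul.
Qed.

Lemma summ0 r : summ r (fun=> 0).
Proof. by split=> [m|s _]; [exact: hom0|exists 0 => // m; rewrite pnr0 mul0r]. Qed.

Lemma summ_le r r' (u : US) : r' <= r -> summ r u -> summ r' u.
Proof.
move=> rr [hu hF]; split=> // s /andP[s0 sr]; apply: hF.
by rewrite s0 (lt_le_trans sr).
Qed.

Lemma summD r (u v : US) : summ r u -> summ r v -> summ r (fun m => u m + v m).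
Proof.
move=> [hu hF] [hv hG]; split=> [m|s sr]; first exact: homD.
have [F F0 hF'] := hF s sr; have [G G0 hG'] := hG s sr; have /andP[s0 _] := sr.
exists (F + G) => [|m]; first exact: addr_ge0.
apply: le_trans (lerD (hF' m) (hG' m)); rewrite -mulrDl.
by apply: ler_wpM2r; [rewrite exprn_ge0 // ltW|apply: pnrD].
Qed.

Lemma summN r (u : US) : summ r u -> summ r (fun m => - u m).
Proof.
move=> [hu hF]; split=> [m|s sr]; first by have := hu m; rewrite /hom !rpredN.
by have [F F0 hF'] := hF s sr; exists F => // m; rewrite pnrN.
Qed.

(* A polynomial loss in [m] is harmless: it is absorbed by passing from [s] to a
   slightly larger radius. *)
Lemma summ_absorb r k (u v : US) : homs v ->
  (forall s F, 0 < s < r -> 0 <= F -> (forall m, pnr m (u m) <= F * s ^- m) ->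
     exists2 G, 0 <= G & forall m, pnr m (v m) <= G * m.+1%:R ^+ k * s ^- m) ->
  summ r u -> summ r v.
Proof.
move=> hv huv [hu hF]; split=> // s /andP[s0 sr].
pose t := (s + r) / 2; have t0 : 0 < t by rewrite /t; lra.
have tr : 0 < t < r by rewrite t0 /= /t; lra.
have st : s < t by rewrite /t; lra.
have [F F0 hF'] := hF t tr.
have [m|G G0 hG] := huv t F tr F0.
  by rewrite ler_pdivlMr ?exprn_gt0.
have [|C C0 hC] := @poly_geom_bound R k (s / t).
  by rewrite divr_ge0 ?ltW //= ltr_pdivrMr // mul1r.
exists (G * C) => [|m]; first exact: mulr_ge0.
have := ler_wpM2r (exprn_ge0 m (ltW s0)) (hG m); move/le_trans; apply.
rewrite -!mulrA ler_wpM2l // (mulrC (t ^- m)) -expr_div_n; exact: hC.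
Qed.

End Norms.

Section Closure.
Variables (R : archiRcfType) (n : nat).
Local Notation M := {mpoly R[n]}.
Local Notation U := (M * M)%type.
Local Notation US := (nat -> U).
Local Notation "d .-homog" := (@ishomog1 _ _ d (@mdeg n)) : ring_scope.
Hypothesis n_gt0 : (0 < n)%N.

Lemma summ_seqd r i (u : US) : summ r u -> summ r (seqd i u).
Proof.
move=> su; apply: (@summ_absorb _ _ r 1 u) (su); first exact: homs_seqd su.1.
move=> s F /andP[s0 sr] F0 hF; exists ((n.+2)%:R * F / s).
  by rewrite divr_ge0 ?mulr_ge0 // ltW.
move=> m; apply: le_trans (pnr_pderiv n_gt0 i (su.1 m.+1)) _.
apply: le_trans (ler_wpM2l _ (hF m.+1)) _; first by [].
rewrite natrM exprS invfM expr1 le_eqVlt; apply/predU1P; left.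
by ring.
Qed.

Lemma summ_seqmul r (a u : US) : summ r a -> summ r u -> summ r (seqmul a u).
Proof.
move=> sa su; apply: (@summ_absorb _ _ r n.+1 u) (su).
  exact: homs_seqmul sa.1 su.1.
move=> s F sr F0 hF; have [A A0 hA] := sa.2 s sr; have /andP[s0 _] := sr.
exists (A * F); first exact: mulr_ge0.
move=> m; apply: (@le_trans _ _ (\sum_(i < m.+1) m.+1%:R ^+ n * (A * s ^- i) * (F * s ^- (m - i)%N))).
  apply: le_trans (pnr_sum _ _ _) _ => // [i _|].
    by rewrite -[X in hom X _](subnKC (leq_ord i)) hom_cmul ?sa.1 ?su.1.
  apply: ler_sum => i _; rewrite -[X in pnr X _](subnKC (leq_ord i)).
  apply: le_trans (pnr_cmul n_gt0 (sa.1 i) (su.1 _)) _.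
  apply: ler_pM => //; rewrite ?mulr_ge0 ?exprn_ge0 ?pnr_ge0 //.
  apply: ler_pM => //; rewrite ?exprn_ge0 ?pnr_ge0 //.
    by rewrite lerXn2r ?nnegrE // ler_nat.
  by rewrite ler_pdivlMr ?exprn_gt0.
rewrite (eq_bigr (fun=> m.+1%:R ^+ n * (A * F) * s ^- m)).
  rewrite sumr_const card_ord -mulr_natr exprSr le_eqVlt; apply/predU1P; left.
  by ring.
move=> i _; have -> : s ^- m = s ^- i * s ^- (m - i)%N.
  by rewrite -invfM -exprD subnKC ?leq_ord.
by ring.
Qed.

Definition seq1 k (u : U) : US := fun m => if m == k then u else 0.

Lemma homs_seq1 k (u : U) : hom k u -> homs (seq1 k u).
Proof. by move=> hu m; rewrite /seq1; case: eqP => [->//|_]; exact: hom0. Qed.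

Lemma summ_seq1 r k (u : U) : hom k u -> summ r (seq1 k u).
Proof.
move=> hu; split=> [|s /andP[s0 _]]; first exact: homs_seq1.
exists (pnr k u * s ^+ k) => [|m]; first by rewrite mulr_ge0 ?pnr_ge0 ?exprn_ge0 ?ltW.
rewrite /seq1; case: eqP => [->//|_].
by rewrite pnr0 mul0r mulr_ge0 ?pnr_ge0 ?exprn_ge0 ?ltW.
Qed.

Lemma seqmul_seq1 k (u : U) (v : US) m :
  seqmul (seq1 k u) v m = if (k <= m)%N then cmul u (v (m - k)%N) else 0.
Proof.
have c0 w : cmul (0 : U) w = 0 :> U by rewrite /cmul /= !mul0r subr0 addr0.
case: leqP => km.
  rewrite /seqmul (bigD1 (inord k)) //= /seq1 inordK // eqxx big1 ?addr0 // => i ik.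
  case: eqP => [E|_]; last by rewrite c0.
  by case/eqP: ik; apply: val_inj; rewrite /= inordK.
by rewrite /seqmul big1 // => i _; rewrite /seq1 ltn_eqF ?c0 // (leq_ltn_trans (leq_ord i)).
Qed.

Definition seqlap (u : US) : US := fun m => \sum_i seqd i (seqd i u) m.

Definition plapn k (u : U) : U := (lapn k u.1, lapn k u.2).

Lemma seqlapE u m : seqlap u m = plapn 1 (u m.+2).
Proof.
rewrite [LHS]surjective_pairing /plapn /lapn /= /lap.
by rewrite (big_morph fst (id1 := 0) (op1 := +%R)) // (big_morph snd (id1 := 0) (op1 := +%R)).
Qed.

Lemma iter_seqlapE k u m : iter k seqlap u m = plapn k (u (m + k.*2)%N).
Proof.
elim: k m => [|k IH] m; first by rewrite addn0 [LHS]surjective_pairing.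
by rewrite iterS seqlapE IH doubleS !addnS addSn.
Qed.

Definition seqdm (alpha : 'X_{1..n}) (u : US) : US :=
  foldr (fun i g => iter (alpha i) (seqd i) g) u (enum 'I_n).

(* [dop k Phi]: [Phi] behaves like a differential operator of order [k], and
   loses at most a factor [O(m^k)] in norm. *)
Definition dop k (Phi : US -> US) := forall u, homs u ->
  [/\ homs (Phi u),
      forall m v, homs v -> u (m + k)%N = v (m + k)%N -> Phi u m = Phi v m &
      forall m, pnr m (Phi u m) <= (n.+2 * (m + k))%:R ^+ k * pnr (m + k) (u (m + k)%N)].

Lemma dop_id : dop 0 id.
Proof. by move=> u hu; split=> // [m v _|m]; rewrite addn0 // mul1r. Qed.

Lemma dop_seqd i : dop 1 (seqd i).
Proof.
move=> u hu; split=> [|m v _|m]; first exact: homs_seqd.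
  by rewrite /seqd addn1 => ->.
by rewrite addn1 expr1; apply: pnr_pderiv.
Qed.

Lemma dop_comp k l Phi Psi : dop k Phi -> dop l Psi -> dop (k + l) (Phi \o Psi).
Proof.
move=> hPhi hPsi u hu; have [hPu loc bnd] := hPsi u hu.
have [hPPu loc' bnd'] := hPhi _ hPu; split=> // [m v hv uv|m] /=.
  by apply: loc'; [have [] := hPsi v hv|apply: loc => //; rewrite -addnA].
apply: le_trans (bnd' m) _; rewrite exprD -mulrA.
have e : (m + (k + l))%N = (m + k + l)%N by rewrite addnA.
apply: ler_pM; rewrite ?exprn_ge0 ?pnr_ge0 //.
  by rewrite lerXn2r ?nnegrE // ler_nat; nia.
by rewrite e; apply: bnd.
Qed.

Lemma dop_iter k Phi l : dop k Phi -> dop (l * k) (iter l Phi).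
Proof.
move=> h; elim: l => [|l IH]; first exact: dop_id.
by rewrite mulSn; apply: (dop_comp h IH).
Qed.

Lemma dop_seqdm alpha : dop (mdeg alpha) (seqdm alpha).
Proof.
rewrite mdegE -big_enum /= /seqdm; elim: (enum _) => [|i s IH] /=.
  by rewrite big_nil; apply: dop_id.
rewrite big_cons -[X in (X + _)%N]muln1.
exact: (dop_comp (dop_iter (alpha i) (@dop_seqd i)) IH).
Qed.

End Closure.

Lemma strong_rec (T : Type) (x0 : T) (F : (nat -> T) -> nat -> T) :
  (forall q q' m, (forall l, (l < m)%N -> q l = q' l) -> F q m = F q' m) ->
  exists q, forall m, q m = F q m.
Proof.
move=> loc; pose Q k := iter k F (fun=> x0).
have stable k l m : (m < k)%N -> (k <= l)%N -> Q k m = Q l m.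
  elim: k l m => // k IH [//|l] m mk kl; rewrite /Q !iterS; apply: loc => j jm.
  by apply: IH => //; apply: leq_trans jm _.
exists (fun m => Q m.+1 m) => m; rewrite /Q iterS; apply: loc => l lm.
by rewrite -/(Q m l) -/(Q l.+1 l); apply/esym/stable.
Qed.

Lemma half_contraction_bounded (R : realFieldType) (b : nat -> R) (C : R) N0 :
  0 <= C -> (forall m, 0 <= b m) ->
  (forall m B, (N0 <= m)%N -> 0 <= B -> (forall l, (l < m)%N -> b l <= B) ->
     b m <= C + B / 2) ->
  exists2 B, 0 <= B & forall m, b m <= B.
Proof.
move=> C0 b0 h; pose B := 2 * C + \sum_(l < N0) b l.
have S0 : 0 <= \sum_(l < N0) b l by apply: sumr_ge0.
have B0 : 0 <= B by rewrite /B; lra.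
exists B => // m; elim/ltn_ind: m => m IH; have [mN|mN] := leqP N0 m.
  by apply: le_trans (h m B mN B0 IH) _; rewrite /B; lra.
rewrite /B (bigD1 (Ordinal mN)) //=.
have : 0 <= \sum_(i < N0 | i != Ordinal mN) b i by apply: sumr_ge0.
lra.
Qed.

(** * The recursion on homogeneous components *)

Section Recursion.
Variables (R : archiRcfType) (n : nat).
Local Notation M := {mpoly R[n]}.
Local Notation U := (M * M)%type.
Local Notation US := (nat -> U).
Local Notation "d .-homog" := (@ishomog1 _ _ d (@mdeg n)) : ring_scope.
Hypothesis n_gt0 : (0 < n)%N.
Variables (p k0 : nat) (P : M) (delta : R).
Hypotheses (p_gt0 : (0 < p)%N) (k0_le : (k0 <= p)%N).
Hypotheses (P_homog : P \is (2 * p).-homog) (delta_gt0 : 0 < delta).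
Hypothesis P_ge : forall x, delta * (rad2 R n ^+ p).@[x] <= P.@[x].

Definition fischerU (u : U) : U := plapn p (cmul (P, 0) u).

Lemma fischerUE u : fischerU u = (lapn p (P * u.1), lapn p (P * u.2)).
Proof. by rewrite /fischerU /plapn /cmul /= !mul0r subr0 addr0. Qed.

Lemma hom_fischerU m u : hom m u -> hom m (fischerU u).
Proof.
by move=> /andP[h1 h2];
  rewrite fischerUE /hom (fischer_homog P_homog h1) (fischer_homog P_homog h2).
Qed.

Lemma fischerU_bound m u : hom m u ->
  delta * m.+1%:R ^+ p * pnr m u <= pnr m (fischerU u).
Proof.
move=> /andP[h1 h2]; rewrite fischerUE /pnr mulrDr.
by rewrite lerD // (fischer_bound n_gt0 P_homog P_ge).
Qed.

Lemma fischerUB u v : fischerU (u - v) = fischerU u - fischerU v.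
Proof. by rewrite !fischerUE; congr (_, _); rewrite mulrBr linearB. Qed.

Lemma fischerU_inj m u v : hom m u -> hom m v -> fischerU u = fischerU v -> u = v.
Proof.
move=> hu hv uv; apply/eqP; rewrite -subr_eq0; apply/eqP; apply: (@pnr_eq0 R n n_gt0 m).
  exact: homB.
have := fischerU_bound (homB hu hv); rewrite fischerUB uv subrr pnr0.
rewrite pmulr_rle0 ?mulr_gt0 ?exprn_gt0 // => h; apply/eqP.
by rewrite eq_le h pnr_ge0.
Qed.

Lemma fischerU_surj m g : exists u, hom m u /\ (hom m g -> fischerU u = g).
Proof.
have [/andP[g1 g2]|] := boolP (hom m g); last by exists 0; rewrite hom0.
have [u1 h1 e1] := fischer_surj n_gt0 P_homog delta_gt0 P_ge g1.
have [u2 h2 e2] := fischer_surj n_gt0 P_homog delta_gt0 P_ge g2.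
by exists (u1, u2); rewrite /hom h1 h2; split=> // _; rewrite fischerUE e1 e2;
  case: g {g1 g2 e1 e2}.
Qed.

Variable a : 'X_{1..n} -> US.
Hypothesis a_homs : forall alpha, (mdeg alpha <= k0)%N -> homs (a alpha).

Definition seqP (q : US) : US := seqmul (seq1 (2 * p) (P, 0)) q.

Definition seqG (q : US) : US := fun m =>
  \sum_(alpha : 'X_{1..n < k0.+1}) seqmul (a alpha) (seqdm alpha (seqP q)) m.

Definition seqL (q : US) : US := fun m => iter p (@seqlap R n) (seqP q) m + seqG q m.

Lemma homP0 : hom (2 * p) (P, 0). Proof. by rewrite /hom P_homog rpred0. Qed.

Lemma homs_seqP q : homs q -> homs (seqP q).
Proof. by move=> hq; apply: homs_seqmul => //; apply/homs_seq1/homP0. Qed.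

Lemma seqPE q m : seqP q m = if (2 * p <= m)%N then cmul (P, 0) (q (m - 2 * p)%N) else 0.
Proof. exact: seqmul_seq1. Qed.

Lemma seqLE q m : seqL q m = fischerU (q m) + seqG q m.
Proof. by rewrite /seqL iter_seqlapE seqPE -mul2n leq_addl addnK. Qed.

Lemma bdeg (alpha : 'X_{1..n < k0.+1}) : (mdeg alpha <= k0)%N.
Proof. by rewrite -ltnS bmdeg. Qed.

Lemma homs_seqG q : homs q -> homs (seqG q).
Proof.
move=> hq m; apply: hom_sum => alpha _; apply: homs_seqmul.
  exact/a_homs/bdeg.
by have [] := dop_seqdm n_gt0 alpha (homs_seqP hq).
Qed.

Lemma seqG_local q q' m : homs q -> homs q' ->
  (forall l, (l < m)%N -> q l = q' l) -> seqG q m = seqG q' m.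
Proof.
move=> hq hq' qq; apply: eq_bigr => alpha _; apply: eq_bigr => i _; congr (cmul _ _).
have [_ loc _] := dop_seqdm n_gt0 alpha (homs_seqP hq).
apply: loc; first exact: homs_seqP.
rewrite !seqPE; case: leqP => // h; congr (cmul _ _); apply: qq.
by have := bdeg alpha; clear -h k0_le p_gt0; lia.
Qed.

Lemma seqL_inj q q' : homs q -> homs q' -> (forall m, seqL q m = seqL q' m) -> q = q'.
Proof.
move=> hq hq' h; apply/funext => m; elim/ltn_ind: m => m IH.
apply: (fischerU_inj (hq m) (hq' m)); have := h m; rewrite !seqLE.
by rewrite (seqG_local hq hq' IH) => /addIr.
Qed.

Lemma seqL_surj (f : US) : homs f -> exists2 q, homs q & forall m, seqL q m = f m.
Proof.
move=> hf; have [sol solP] := boolp.choice (fun mg : nat * U => fischerU_surj mg.1 mg.2).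
pose cut (q : US) : US := fun m => if hom m (q m) then q m else 0.
have hcut q : homs (cut q) by move=> m; rewrite /cut; case: ifP => // _; apply: hom0.
have [|q qE] := @strong_rec U 0 (fun q m => sol (m, f m - seqG (cut q) m)).
  move=> q q' m qq; congr (sol (_, _ - _)); apply: seqG_local => // l lm.
  by rewrite /cut qq.
have hq : homs q by move=> m; rewrite qE; have [] := solP (m, f m - seqG (cut q) m).
exists q => // m; have qcut : cut q = q by apply/funext => l; rewrite /cut hq.
have := qE m; rewrite qcut seqLE => ->; have [_] := solP (m, f m - seqG q m).
by move=> -> /=; [rewrite subrK|apply: homB => //; apply: homs_seqG].
Qed.

Lemma pnr_seqP q l : homs q ->
  pnr (l + 2 * p) (seqP q (l + 2 * p)%N) <= (2 * p).+1%:R ^+ n * nr (2 * p) P * pnr l (q l).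
Proof.
move=> hq; rewrite seqPE leq_addl addnK addnC.
apply: le_trans (pnr_cmul n_gt0 homP0 (hq l)) _.
by rewrite /pnr /= nr0 addr0.
Qed.

Definition cG : R := ((n.+2 * p.+1)%:R ^+ k0) * ((2 * p).+1%:R ^+ n * nr (2 * p) P).

Lemma cG_ge0 : 0 <= cG.
Proof. by rewrite !mulr_ge0 ?exprn_ge0 ?nr_ge0. Qed.

Lemma seqG_bound q (r s A B : R) m : homs q -> 0 < r < s -> 0 <= A -> 0 <= B ->
  (forall alpha i, (mdeg alpha <= k0)%N ->
     i.+1%:R ^+ n * pnr i (a alpha i) * s ^+ i <= A) ->
  (forall l, (l < m)%N -> pnr l (q l) * r ^+ l <= B) ->
  pnr m (seqG q m) * r ^+ m <=
    A * cG * (\sum_(alpha : 'X_{1..n < k0.+1}) r ^+ (2 * p - mdeg alpha)) /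
    (1 - r / s) * m.+1%:R ^+ k0 * B.
Proof.
move=> hq /andP[r0 rs] A0 B0 hA hB; have s0 : 0 < s by apply: lt_trans rs.
have rm0 k : 0 <= r ^+ k by rewrite exprn_ge0 // ltW.
have t01 : 0 <= r / s < 1 by rewrite divr_ge0 ?ltW //= ltr_pdivrMr // mul1r.
have hw := homs_seqP hq.
have hd (alpha : 'X_{1..n < k0.+1}) := dop_seqdm n_gt0 alpha hw.
pose T (alpha : 'X_{1..n < k0.+1}) := r ^+ (2 * p - mdeg alpha).
suff H (alpha : 'X_{1..n < k0.+1}) :
    pnr m (seqmul (a alpha) (seqdm alpha (seqP q)) m) * r ^+ m <=
    T alpha * (A * cG * m.+1%:R ^+ k0 * B / (1 - r / s)).
  apply: le_trans (ler_wpM2r (rm0 m) (pnr_sum n_gt0 _ _)) _.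
    move=> alpha _; apply: homs_seqmul; first exact/a_homs/bdeg.
    by have [] := hd alpha.
  rewrite mulr_suml; apply: le_trans (ler_sum _ (fun alpha _ => H alpha)) _.
  rewrite -mulr_suml le_eqVlt; apply/predU1P; left; rewrite /T.
  by ring.
have [hda _ bnd] := hd alpha; have al := bdeg alpha.
have T0 : 0 <= T alpha by exact: rm0.
have X0 : 0 <= A * cG * m.+1%:R ^+ k0 * B.
  by rewrite mulr_ge0 // mulr_ge0 ?exprn_ge0 // mulr_ge0 // cG_ge0.
apply: le_trans (ler_wpM2r (rm0 m) (pnr_sum n_gt0 _ _)) _.
  move=> i _; rewrite -[X in hom X _](subnKC (leq_ord i)).
  by apply: hom_cmul => //; apply: a_homs.
rewrite mulr_suml; apply: (@le_trans _ _
   (\sum_(i < m.+1) T alpha * (A * cG * m.+1%:R ^+ k0 * B) * (r / s) ^+ i)); last first.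
  rewrite -mulr_sumr -mulrA ler_wpM2l // ler_wpM2l ?geom_sum_le //.
apply: ler_sum => i _; have im := leq_ord i.
have e1 : pnr m (cmul (a alpha i) (seqdm alpha (seqP q) (m - i)%N)) <=
   i.+1%:R ^+ n * pnr i (a alpha i) * pnr (m - i) (seqdm alpha (seqP q) (m - i)%N).
  rewrite -[X in pnr X _ <= _](subnKC im); apply: pnr_cmul => //.
  exact: a_homs.
apply: le_trans (ler_wpM2r (rm0 m) e1) _.
have [h|h] := leqP (2 * p) (m - i + mdeg alpha); last first.
  have -> : pnr (m - i) (seqdm alpha (seqP q) (m - i)%N) = 0.
    apply/eqP; rewrite eq_le pnr_ge0 andbT; apply: le_trans (bnd _) _.
    by rewrite seqPE leqNgt h /= pnr0 mulr0.
  rewrite mulr0 mul0r; apply: mulr_ge0; first exact: mulr_ge0 T0 X0.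
  by apply: exprn_ge0; case/andP: t01.
pose l := (m - i + mdeg alpha - 2 * p)%N.
have lE : (m - i + mdeg alpha = l + 2 * p)%N by rewrite subnK.
have e2 : pnr (m - i) (seqdm alpha (seqP q) (m - i)%N) <=
    cG * m.+1%:R ^+ k0 * pnr l (q l).
  apply: le_trans (bnd _) _; rewrite lE.
  apply: le_trans (ler_wpM2l _ (pnr_seqP l hq)) _; first exact: exprn_ge0.
  rewrite /cG [leRHS](_ : _ = ((n.+2 * p.+1)%:R ^+ k0 * m.+1%:R ^+ k0) *
    ((2 * p).+1%:R ^+ n * nr (2 * p) P * pnr l (q l))); last by ring.
  apply: ler_wpM2r; first by rewrite !mulr_ge0 ?exprn_ge0 ?nr_ge0 ?pnr_ge0.
  rewrite -exprMn -natrM -!natrX ler_nat;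
    apply: (@leq_trans ((n.+2 * p.+1 * m.+1) ^ mdeg alpha)).
    have : (n.+2 * (l + 2 * p) <= n.+2 * p.+1 * m.+1)%N.
      by rewrite -mulnA leq_mul2l -lE; clear -al k0_le; nia.
    by elim: (mdeg alpha) => // k IHk h'; rewrite !expnS leq_mul // IHk.
  by rewrite leq_pexp2l.
have lm : (l < m)%N by clear -lE al im k0_le p_gt0; lia.
apply: le_trans (ler_wpM2r (rm0 m) (ler_wpM2l _ e2)) _.
  by rewrite mulr_ge0 ?exprn_ge0 ?pnr_ge0.
have mE : r ^+ m = r ^+ i * (T alpha * r ^+ l).
  by rewrite /T -!exprD; congr (_ ^+ _); clear -lE al im k0_le p_gt0; lia.
have sE : (r / s) ^+ i = r ^+ i / s ^+ i by rewrite expr_div_n.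
have := hA alpha i al; rewrite -ler_pdivlMr ?exprn_gt0 // => hAi.
rewrite mE sE [leRHS](_ : _ = (A / s ^+ i) * (cG * m.+1%:R ^+ k0 * T alpha * r ^+ i) * B);
  last by ring.
rewrite [leLHS](_ : _ = (i.+1%:R ^+ n * pnr i (a alpha i)) *
  (cG * m.+1%:R ^+ k0 * T alpha * r ^+ i) *
  (pnr l (q l) * r ^+ l)); last by ring.
have Y0 : 0 <= cG * m.+1%:R ^+ k0 * T alpha * r ^+ i.
  by rewrite mulr_ge0 // mulr_ge0 // mulr_ge0 ?exprn_ge0 // cG_ge0.
have N0 : 0 <= i.+1%:R ^+ n * pnr i (a alpha i) by rewrite mulr_ge0 ?exprn_ge0 ?pnr_ge0.
apply: ler_pM; [exact: mulr_ge0 N0 Y0|by rewrite mulr_ge0 ?pnr_ge0|exact: ler_wpM2r|].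
exact: hB.
Qed.

Variable rho : R.
Hypothesis a_summ : forall alpha, (mdeg alpha <= k0)%N -> summ rho (a alpha).

Lemma coef_bound s : 0 < s < rho -> exists2 A, 0 <= A &
  forall alpha i, (mdeg alpha <= k0)%N ->
     i.+1%:R ^+ n * pnr i (a alpha i) * s ^+ i <= A.
Proof.
move=> /andP[s0 sr]; pose t := (s + rho) / 2.
have t0 : 0 < t by rewrite /t; lra.
have tr : 0 < t < rho by rewrite t0 /= /t; lra.
have st : s < t by rewrite /t; lra.
have [|C C0 hC] := @poly_geom_bound R n (s / t).
  by rewrite divr_ge0 ?ltW //= ltr_pdivrMr // mul1r.
have /fin_all_exists[A hA] : forall alpha : 'X_{1..n < k0.+1}, exists A, 0 <= A /\
    forall i, i.+1%:R ^+ n * pnr i (a alpha i) * s ^+ i <= A.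
  move=> alpha; have [_ /(_ t tr)[F F0 hF]] := a_summ (bdeg alpha).
  exists (C * F); split=> [|i]; first exact: mulr_ge0.
  apply: le_trans (ler_pM _ _ (hC i) (hF i));
    last by rewrite mulr_ge0 ?pnr_ge0 // exprn_ge0 // ltW.
    rewrite le_eqVlt; apply/predU1P; left; rewrite expr_div_n.
    by field; rewrite expf_neq0 // gt_eqF.
  by rewrite mulr_ge0 // exprn_ge0 // divr_ge0 // ltW.
exists (\sum_alpha A alpha) => [|alpha i al]; first by apply: sumr_ge0 => alpha _;
  case: (hA alpha).
have lt_al : (mdeg alpha < k0.+1)%N by [].
apply: le_trans ((hA (BMultinom lt_al)).2 i) _.
by rewrite (bigD1 (BMultinom lt_al)) //= lerDl sumr_ge0 // => b _; case: (hA b).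
Qed.

Lemma recursion_bound s : 0 < s < rho -> exists2 Q, 0 <= Q &
  forall r (q f : US) m B, 0 < r < s -> homs q -> (forall m, seqL q m = f m) ->
    0 <= B -> (forall l, (l < m)%N -> pnr l (q l) * r ^+ l <= B) ->
  pnr m (q m) * r ^+ m <= delta^-1 * (pnr m (f m) * r ^+ m) +
    Q * (\sum_(alpha : 'X_{1..n < k0.+1}) r ^+ (2 * p - mdeg alpha)) / (1 - r / s) *
    (m.+1%:R ^+ k0 / m.+1%:R ^+ p) * B.
Proof.
move=> sr; have [A A0 hA] := coef_bound sr; have /andP[s0 _] := sr.
exists (delta^-1 * (A * cG)) => [|r q f m B rs hq qf B0 hB].
  by rewrite mulr_ge0 ?invr_ge0 ?(ltW delta_gt0) // mulr_ge0 // cG_ge0.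
have /andP[r0 rs'] := rs; have rm0 : 0 <= r ^+ m by rewrite exprn_ge0 // ltW.
have G := seqG_bound hq rs A0 B0 hA hB; set S := \sum_(_ : _) _ in G *.
have E : fischerU (q m) = f m - seqG q m by rewrite -qf seqLE addrK.
have hf : hom m (f m).
  by rewrite -qf seqLE homD ?hom_fischerU // homs_seqG.
have := fischerU_bound (hq m); rewrite E => h.
have {h} h := le_trans h (pnrB n_gt0 hf (homs_seqG hq m)).
have mp : 0 < m.+1%:R ^+ p :> R by rewrite exprn_gt0.
have dm : 0 < delta * m.+1%:R ^+ p by rewrite mulr_gt0.
have {}h : delta * m.+1%:R ^+ p * (pnr m (q m) * r ^+ m) <= pnr m (f m) * r ^+ m +
    A * cG * S / (1 - r / s) * m.+1%:R ^+ k0 * B.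
  by apply: le_trans (lerD (lexx _) G); rewrite mulrA -mulrDl ler_wpM2r.
rewrite -(ler_pM2l dm); apply: le_trans h _; rewrite mulrDr lerD //.
  rewrite [leRHS](_ : _ = m.+1%:R ^+ p * (pnr m (f m) * r ^+ m)).
    by rewrite ler_peMl ?mulr_ge0 ?pnr_ge0 // exprn_ege1 // ler1n.
  by field; rewrite gt_eqF.
rewrite le_eqVlt; apply/predU1P; left; field.
rewrite !gt_eqF ?subr_gt0 //.
Qed.

Lemma summ_of_bounded r (q : US) B : homs q ->
  (forall m, pnr m (q m) * r ^+ m <= B) -> 0 <= B -> summ r q.
Proof.
move=> hq hB B0; split=> // s /andP[s0 sr]; exists B => // m.
apply: le_trans (hB m); rewrite ler_wpM2l ?pnr_ge0 // lerXn2r ?nnegrE ?ltW //.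
exact: lt_trans sr.
Qed.

Lemma seqL_summ_lt (q f : US) : (k0 < p)%N -> homs q -> (forall m, seqL q m = f m) ->
  summ rho f -> summ rho q.
Proof.
move=> k0p hq qf [_ hf]; split=> // r /andP[r0 rr]; pose s := (r + rho) / 2.
have s0 : 0 < s by rewrite /s; lra.
have sr : 0 < s < rho by rewrite s0 /= /s; lra.
have rs : 0 < r < s by rewrite r0 /= /s; lra.
have [F F0 hF] := hf r (introT andP (conj r0 rr)); have [Q Q0 hQ] := recursion_bound sr.
pose S : R := \sum_(alpha : 'X_{1..n < k0.+1}) r ^+ (2 * p - mdeg alpha).
have S0 : 0 <= S by apply: sumr_ge0 => alpha _; rewrite exprn_ge0 // ltW.
pose D := Q * S / (1 - r / s).
have D0 : 0 <= D.
  by rewrite divr_ge0 ?mulr_ge0 // subr_ge0 ler_pdivrMr // mul1r ltW //; case/andP: rs.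
apply: (@half_contraction_bounded _ _ (delta^-1 * F) (Num.bound (2 * D))).
- by rewrite mulr_ge0 // invr_ge0 ltW.
- by move=> m; rewrite mulr_ge0 ?pnr_ge0 // exprn_ge0 // ltW.
move=> m B hm B0 hB; apply: le_trans (hQ r q f m B rs hq qf B0 hB) _; rewrite -/S -/D.
apply: lerD; first by rewrite ler_wpM2l // invr_ge0 ltW.
rewrite [leRHS]mulrC ler_wpM2r //.
have m0 : 0 < m.+1%:R :> R by [].
have : m.+1%:R ^+ k0 / m.+1%:R ^+ p <= m.+1%:R^-1 :> R.
  rewrite ler_pdivrMr ?exprn_gt0 // mulrC ler_pdivlMr // -exprSr.
  by rewrite ler_weXn2l // ler1n.
move/(ler_wpM2l D0)/le_trans; apply; rewrite ler_pdivrMr //.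
have : 2 * D < m.+1%:R.
  apply: lt_le_trans (archi_boundP _) _; first by rewrite mulr_ge0.
  by rewrite ler_nat; apply: leq_trans hm _.
by lra.
Qed.

Lemma seqL_summ_eq : 0 < rho -> k0 = p ->
  exists r, [/\ 0 < r, r <= rho & forall q f : US, homs q ->
    (forall m, seqL q m = f m) -> summ rho f -> summ r q].
Proof.
move=> rho0 k0p; pose s := rho / 2; have s0 : 0 < s by rewrite /s; lra.
have sr : 0 < s < rho by rewrite s0 /= /s; lra.
have [Q Q0 hQ] := recursion_bound sr.
pose N : R := #|{: 'X_{1..n < k0.+1}}|%:R; have N0 : 0 <= N by [].
pose K := 4 * Q * N + 1 + 2 / s.
have K1 : 1 <= K by rewrite /K; have := divr_ge0 (ler0n R 2) (ltW s0);
  have := mulr_ge0 Q0 N0; lra.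
have K0 : 0 < K by lra.
pose r := K^-1; have r0 : 0 < r by rewrite invr_gt0.
have r1 : r <= 1 by rewrite invf_le1.
have rs2 : r <= s / 2.
  rewrite -[s / 2]invrK invf_div lef_pV2 ?posrE ?divr_gt0 // /K.
  by have := mulr_ge0 Q0 N0; lra.
have rs : 0 < r < s by rewrite r0 /=; lra.
have QN : 4 * (Q * N * r) <= 1.
  rewrite mulrA ler_pdivrMr // mul1r /K; have := divr_ge0 (ler0n R 2) (ltW s0); lra.
exists r; split=> //; first by rewrite /s in rs2; lra.
move=> q f hq qf [_ hf].
have r_in : 0 < r < rho by rewrite r0 /=; rewrite /s in rs2; lra.
have [F F0 hF] := hf r r_in.
suff [B B0 hB] : exists2 B, 0 <= B & forall m, pnr m (q m) * r ^+ m <= B.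
  exact: summ_of_bounded hB B0.
apply: (@half_contraction_bounded _ _ (delta^-1 * F) 0).
- by rewrite mulr_ge0 // invr_ge0 ltW.
- by move=> m; rewrite mulr_ge0 ?pnr_ge0 // exprn_ge0 // ltW.
move=> m B _ B0 hB; apply: le_trans (hQ r q f m B rs hq qf B0 hB) _.
apply: lerD; first by rewrite ler_wpM2l // invr_ge0 ltW.
have -> : m.+1%:R ^+ k0 / m.+1%:R ^+ p = 1 :> R.
  by rewrite k0p divff // expf_neq0 // pnatr_eq0.
rewrite mulr1 [leRHS]mulrC ler_wpM2r //.
set S := \sum_(_ : _) _.
have SN : S <= N * r.
  have -> : N * r = \sum_(alpha : 'X_{1..n < k0.+1}) r by rewrite sumr_const mulr_natl.
  apply: ler_sum => alpha _.
  rewrite -[leRHS]expr1; apply: (ler_wiXn2l (ltW r0) r1).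
  by have := bdeg alpha; clear -k0p p_gt0; lia.
have d2 : 1 / 2 <= 1 - r / s.
  by have : r / s <= 1 / 2; [rewrite ler_pdivrMr // mul1r mulrC|lra].
rewrite ler_pdivrMr; last by lra.
have := ler_wpM2l Q0 SN; rewrite mulrA; lra.
Qed.

End Recursion.

Section Line2.
Variables (R : rcfType) (n : nat).
Local Notation M := {mpoly R[n]}.
Implicit Types (p : M) (x : 'I_n -> R).

Lemma poly_mvt0 (q : {poly R}) h :
  exists2 c, `|c| <= `|h| & q.[h] - q.[0] = q^`().[c] * h.
Proof.
have [h0|h0|->] := ltgtP h 0; last by exists 0; rewrite ?normr0 ?mulr0 ?subrr.
- have [c /itvP hc E] := poly_mvt q h0.
  have hl : h <= c by rewrite hc.
  have cl : c <= 0 by rewrite hc.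
  exists c; first by rewrite !ler0_norm ?(ltW h0) // lerN2.
  by rewrite -opprB E sub0r mulrN opprK.
- have [c /itvP hc E] := poly_mvt q h0.
  have hl : c <= h by rewrite hc.
  have cl : 0 <= c by rewrite hc.
  exists c; first by rewrite !ger0_norm ?(ltW h0).
  by rewrite E subr0.
Qed.

Lemma meval_second_order p x i h K :
  (forall t, `|t| <= `|h| ->
     `|p^`M(i)^`M(i).@[fun j => x j + t * (j == i)%:R]| <= K) ->
  `|p.@[fun j => x j + h * (j == i)%:R] - p.@[x] - h * p^`M(i).@[x]| <= K * h ^+ 2.
Proof.
move=> hK; have E q : q.@[x] = (line x i q).[0].
  by rewrite horner_line; apply: meval_eq => j; rewrite mul0r addr0.
rewrite !E -horner_line; have [c ch ->] := poly_mvt0 (line x i p) h.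
rewrite mulrC -mulrBr deriv_line; have [c' cc ->] := poly_mvt0 (line x i p^`M(i)) c.
rewrite deriv_line horner_line 2!normrM; have := hK c' (le_trans cc ch) => h2.
rewrite mulrCA expr2 -[h * h]ger0_norm ?sqr_ge0 // normrM.
by apply: ler_pM => //; rewrite ?mulr_ge0 // ler_wpM2l.
Qed.

End Line2.

Section TaylorCoef.
Variables (R : archiRcfType) (n : nat).
Local Notation M := {mpoly R[n]}.
Local Notation US := (nat -> (M * M)%type).
Local Notation "d .-homog" := (@ishomog1 _ _ d (@mdeg n)) : ring_scope.

Lemma seqdmE alpha (u : US) m :
  seqdm alpha u m = ((u (m + mdeg alpha)%N).1^`M[alpha], (u (m + mdeg alpha)%N).2^`M[alpha]).
Proof.
rewrite mdegE -big_enum /= /seqdm /mderivm; elim: (enum _) m => [|i s IH] m /=.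
  by rewrite big_nil addn0; case: (u m).
rewrite big_cons; elim: (alpha i) m => [|k IHk] m; first by rewrite /= IH.
by rewrite iterS {1}/seqd IHk /pderiv /= addSnnS.
Qed.

Lemma mcoeff0_mderivm alpha (p : M) :
  (p^`M[alpha])@_0%MM = p@_alpha *+ \prod_i (alpha i)`!.
Proof.
rewrite mcoeff_mderivm addm0; congr (_ *+ _); apply: eq_bigr => i _.
by rewrite ffactnn.
Qed.

Lemma meval_homog m (p : M) x : p \is m.-homog ->
  p.@[x] = \sum_(alpha : 'X_{1..n < m.+1} | mdeg alpha == m)
    p@_alpha * \prod_i x i ^+ alpha i.
Proof.
move=> hp; rewrite -{1}(pihomog_dE hp) (@pihomogwE _ _ _ _ m.+1); last first.
  rewrite mmeasureE; apply/bigmax_leqP_seq => b.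
  by rewrite mcoeff_msupp => /(homogP _ _ hp) <-.
rewrite linear_sum; apply: eq_bigr => alpha _ /=.
by rewrite mevalZ mevalX.
Qed.

Lemma meval0_homog m (p : M) : p \is m.+1.-homog -> p.@[fun=> 0] = 0.
Proof.
move=> /homogP hp; rewrite mevalf0; apply/eqP; apply: contraT => /hp.
by rewrite mdeg0.
Qed.

Lemma meval_scale m (p : M) c x : p \is m.-homog ->
  p.@[fun i => c * x i] = c ^+ m * p.@[x].
Proof.
move=> hp; rewrite !(meval_homog _ hp) mulr_sumr; apply: eq_bigr => alpha /eqP am.
rewrite [RHS]mulrCA; congr (_ * _).
have -> : c ^+ m = \prod_i c ^+ alpha i by rewrite prodrXr -mdegE am.
rewrite -big_split.
by apply: eq_bigr => i _; rewrite exprMn.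
Qed.

Lemma homog_of_coefs m (c : 'X_{1..n} -> R) : exists p : M, p \is m.-homog /\
  forall alpha, mdeg alpha = m -> p@_alpha = c alpha.
Proof.
exists (hpoly (\row_(k < hdim n m) c (mono k))); split; first exact: hpoly_homog.
by move=> alpha /mono_surj[k <-]; rewrite mcoeff_hpoly mxE.
Qed.

End TaylorCoef.

End HomogeneousPolynomials.

From mathcomp Require Import all_boot all_order all_algebra.
From mathcomp Require Import boolp classical_sets functions.
From mathcomp Require Import reals topology normedtype sequences derive realfun.
From mathcomp.multinomials Require Import (coercions, canonicals) mpoly.

Import Order.TTheory GRing.Theory Num.Theory.
Import numFieldNormedType.Exports.
Import HomogeneousPolynomials.

Local Open Scope classical_set_scope.
Local Open Scope ring_scope.

(** * Functions represented by homogeneous series *)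

Section Modulus.
Variable R : realType.
Local Notation C := (Rcomplex R).
Local Notation cRe := (@complex.Re R).
Local Notation cIm := (@complex.Im R).
Implicit Types z w : C.

Definition cplx (a b : R) : C := Complex a b.

Lemma cnormE z : `|z| = Num.sqrt (cRe z ^+ 2 + cIm z ^+ 2) :> R.
Proof. by case: z. Qed.

Lemma cnormM z w : `|(z * w : C)| = `|z| * `|w| :> R.
Proof.
rewrite !cnormE -sqrtrM ?addr_ge0 ?sqr_ge0 //; congr Num.sqrt.
case: z w => [a b] [c d] /=; ring.
Qed.

Lemma cnorm_le z : `|z| <= `|cRe z| + `|cIm z|.
Proof.
rewrite cnormE -ler_sqr ?nnegrE ?sqrtr_ge0 ?addr_ge0 //.
rewrite sqr_sqrtr ?addr_ge0 ?sqr_ge0 // sqrrD !real_normK ?num_real //.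
by rewrite -addrA lerD2l lerDr mulrn_wge0 // mulr_ge0.
Qed.

Lemma cnorm_Re z : `|cRe z| <= `|z|.
Proof. by rewrite cnormE -sqrtr_sqr ler_sqrt ?addr_ge0 ?sqr_ge0 // lerDl sqr_ge0. Qed.

Lemma cnorm_Im z : `|cIm z| <= `|z|.
Proof. by rewrite cnormE -sqrtr_sqr ler_sqrt ?addr_ge0 ?sqr_ge0 // lerDr sqr_ge0. Qed.

Lemma cplxD a b c d : cplx (a + c) (b + d) = cplx a b + cplx c d.
Proof. by []. Qed.
Lemma cplxB a b c d : cplx (a - c) (b - d) = cplx a b - cplx c d.
Proof. by []. Qed.
Lemma cplxZ t a b : cplx (t * a) (t * b) = t *: cplx a b.
Proof. by []. Qed.
Lemma cplxM a b c d : cplx (a * c - b * d) (a * d + b * c) = cplx a b * cplx c d.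
Proof. by []. Qed.

End Modulus.

Section Evaluation.
Variables (R : realType) (n : nat).
Local Notation E := 'rV[R]_n.
Local Notation C := (Rcomplex R).
Local Notation M := (mpoly.mpoly n R).
Local Notation U := (M * M)%type.
Local Notation US := (nat -> U).
Hypothesis n_gt0 : (0 < n)%N.

Definition ev (u : U) (x : E) : C := cplx (mpoly.meval (x 0) u.1) (mpoly.meval (x 0) u.2).

Lemma ev0 x : ev 0 x = 0. Proof. by rewrite /ev !mpoly.meval0. Qed.
Lemma evD u v x : ev (u + v) x = ev u x + ev v x.
Proof. by rewrite /ev !mpoly.mevalD cplxD. Qed.
Lemma evB u v x : ev (u - v) x = ev u x - ev v x.
Proof. by rewrite /ev !mpoly.mevalB cplxB. Qed.
Lemma ev_sum (I : Type) (r : seq I) (Q : pred I) (F : I -> U) x :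
  ev (\sum_(i <- r | Q i) F i) x = \sum_(i <- r | Q i) ev (F i) x.
Proof. by apply: (big_morph (ev^~ x)) => [u v|]; [exact: evD|exact: ev0]. Qed.
Lemma ev_cmul u v x : ev (cmul u v) x = ev u x * ev v x.
Proof. by rewrite /ev mpoly.mevalB mpoly.mevalD !mpoly.mevalM cplxM. Qed.

Lemma sqrt_rad2 (x : E) : Num.sqrt (mpoly.meval (x 0) (rad2 R n)) = enorm x.
Proof. by rewrite meval_rad2. Qed.

Lemma enorm_ge0 (x : E) : 0 <= enorm x. Proof. exact: sqrtr_ge0. Qed.

Lemma ev_norm m u x : hom m u -> `|ev u x| <= m.+1%:R ^+ n * pnr m u * enorm x ^+ m.
Proof.
move=> /andP[h1 h2]; apply: le_trans (cnorm_le _) _.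
rewrite /pnr mulrDr mulrDl lerD //= -sqrt_rad2; exact: meval_norm_le.
Qed.

Lemma pnr_le_sup m u (A : R) : hom m u -> 0 <= A ->
  (forall x, `|ev u x| <= A * enorm x ^+ m) -> pnr m u <= A *+ 2.
Proof.
move=> /andP[h1 h2] A0 hA; rewrite mulr2n.
have key (q : M) (x : E) : `|mpoly.meval (x 0) q| <= `|ev u x| ->
   mpoly.meval (x 0) q ^+ 2 <= A ^+ 2 * mpoly.meval (x 0) (rad2 R n) ^+ m.
  move=> /le_trans/(_ (hA x)); rewrite -ler_sqr ?nnegrE ?mulr_ge0 ?exprn_ge0 ?enorm_ge0 //.
  rewrite real_normK ?num_real // [leRHS]exprMn -exprM mulnC exprM -sqrt_rad2.
  by rewrite sqr_sqrtr // meval_rad2_ge0.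
have row (y : 'I_n -> R) : exists x : E, x 0 =1 y.
  by exists (\row_i y i) => i; rewrite mxE.
apply: lerD; apply: nr_le_sup => // y; have [x xy] := row y;
  rewrite -!(mpoly.meval_eq _ xy); apply: key;
    [exact: (cnorm_Re (ev u x))|exact: (cnorm_Im (ev u x))].
Qed.

Definition psum (u : US) N x : C := \sum_(m < N) ev (u m) x.

Definition rep r (f : E -> C) (u : US) := summ r u /\
  forall x, eball r x -> forall e, 0 < e ->
    exists N0, forall N, (N0 <= N)%N -> `|f x - psum u N x| <= e.

Lemma summ_ev_geom r u s : 0 < s < r -> summ r u ->
  exists C t, [/\ 0 <= C, 0 <= t < 1 &
    forall x, enorm x <= s -> forall m, `|ev (u m) x| <= C * t ^+ m].
Proof.
move=> /andP[s0 sr] [hu hF]; pose s' := (s + r) / 2.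
have s'0 : 0 < s' by rewrite /s'; lra.
have [|F F0 hF'] := hF s'; first by rewrite s'0 /= /s'; lra.
pose t := s / s'; have t01 : 0 <= t < 1.
  by rewrite divr_ge0 ?ltW //= ltr_pdivrMr // mul1r /s'; lra.
have st01 : 0 <= Num.sqrt t < 1 by rewrite sqrtr_ge0 -sqrtr1 ltr_sqrt //; case/andP: t01.
have [K K0 hK] := poly_geom_bound n st01; have /andP[t0 t1] := t01.
exists (K * F), (Num.sqrt t); split=> //; first exact: mulr_ge0.
move=> x xs m; apply: le_trans (ev_norm x (hu m)) _.
have h1 : enorm x ^+ m <= s ^+ m.
  by rewrite lerXn2r ?nnegrE ?enorm_ge0 // ltW.
have h2 : s ^+ m = s' ^+ m * (Num.sqrt t ^+ m * Num.sqrt t ^+ m).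
  by rewrite -exprMn -expr2 sqr_sqrtr // /t -exprMn mulrC divfK // gt_eqF.
apply: (@le_trans _ _ ((m.+1%:R ^+ n * Num.sqrt t ^+ m) * (pnr m
  (u m) * s' ^+ m) * Num.sqrt t ^+ m)).
  rewrite [leRHS](_ : _ = m.+1%:R ^+ n * pnr m (u m) * s ^+ m); last by rewrite h2; ring.
  by rewrite ler_wpM2l // mulr_ge0 ?exprn_ge0 ?pnr_ge0.
rewrite ler_wpM2r ?exprn_ge0 ?sqrtr_ge0 //.
apply: ler_pM => //; first by rewrite mulr_ge0 ?exprn_ge0 ?sqrtr_ge0.
by rewrite mulr_ge0 ?pnr_ge0 // exprn_ge0 // ltW.
Qed.

Lemma psum_cauchy (u : US) x (K t : R) N L : 0 <= t < 1 -> 0 <= K ->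
  (forall m, `|ev (u m) x| <= K * t ^+ m) -> (N <= L)%N ->
  `|psum u L x - psum u N x| <= K / (1 - t) * t ^+ N.
Proof.
move=> t01 K0 hK NL; have /andP[t0 t1] := t01.
rewrite -(subnKC NL); move: (L - N)%N => k.
have -> : psum u (N + k) x - psum u N x = \sum_(m < k) ev (u (N + m)%N) x.
  by rewrite /psum big_split_ord /= [LHS]addrC addKr.
apply: le_trans (ler_norm_sum _ _ _) _.
apply: (@le_trans _ _ (\sum_(m < k) (K * t ^+ N) * t ^+ m)).
  by apply: ler_sum => m _; rewrite -mulrA -exprD.
rewrite -mulr_sumr [leLHS]mulrAC; apply: ler_wpM2r; first exact: exprn_ge0.
by apply: ler_wpM2l (geom_sum_le _ t01).
Qed.

Lemma ler_epsP (a b : R) : (forall e, 0 < e -> a <= b + e) -> a <= b.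
Proof. by move=> h; apply/ler_addgt0Pr. Qed.

Lemma rep_tail r f u s : 0 < s < r -> rep r f u ->
  exists C t, [/\ 0 <= C, 0 <= t < 1 & forall x, enorm x <= s ->
    (forall m, `|ev (u m) x| <= C * t ^+ m) /\
    (forall N, `|f x - psum u N x| <= C * t ^+ N)].
Proof.
move=> sr [su hf]; have [K [t [K0 t01 hK]]] := summ_ev_geom sr su.
have /andP[t0 t1] := t01; have d0 : 0 < 1 - t by rewrite subr_gt0.
have KK : K <= K / (1 - t) by rewrite ler_pdivlMr // ler_piMr // gerBl.
exists (K / (1 - t)), t; split=> //; first by rewrite divr_ge0 // ltW.
move=> x xs; split=> [m|N].
  by apply: le_trans (hK x xs m) _; rewrite ler_wpM2r // exprn_ge0.
apply: ler_epsP => e e0; have [|N0 hN0] := hf x _ e e0.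
  by rewrite /eball /=; apply: le_lt_trans xs _; case/andP: sr.
pose L := maxn N N0; rewrite -(subrKA (psum u L x)) addrC.
apply: le_trans (ler_normD _ _) _; apply: lerD; last first.
  exact/hN0/leq_maxr.
by apply: psum_cauchy => //; [exact: hK|exact: leq_maxl].
Qed.

End Evaluation.

Lemma poly_geom_small (R : realType) k (t e : R) : 0 <= t < 1 -> 0 < e ->
  exists N0, forall N, (N0 <= N)%N -> N.+1%:R ^+ k * t ^+ N <= e.
Proof.
move=> t01 e0; have [K K0 hK] := poly_geom_bound k.+1 t01.
exists (Num.bound (K / e)) => N hN.
have KN : K / e < N.+1%:R.
  apply: lt_le_trans (archi_boundP _) _; first by rewrite divr_ge0 // ltW.
  by rewrite ler_nat; apply: leq_trans hN _.
have N0 : 0 < N.+1%:R :> R by [].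
rewrite -(ler_pM2l N0) mulrA -exprS; apply: le_trans (hK N) _.
by rewrite -ler_pdivrMr // ltW.
Qed.

Section RepOps.
Variables (R : realType) (n : nat).
Local Notation E := 'rV[R]_n.
Local Notation C := (Rcomplex R).
Local Notation M := (mpoly.mpoly n R).
Local Notation U := (M * M)%type.
Local Notation US := (nat -> U).
Hypothesis n_gt0 : (0 < n)%N.
Implicit Types (f g : E -> C) (u v : US) (r : R).

Lemma rep_ext r f g u : (forall x, eball r x -> f x = g x) -> rep r f u -> rep r g u.
Proof. by move=> fg [su hf]; split=> // x xr; rewrite -fg //; apply: hf. Qed.

Lemma rep_le r r' f u : r' <= r -> rep r f u -> rep r' f u.
Proof.
move=> rr [su hf]; split; first exact: summ_le su.
by move=> x xr; apply: hf; rewrite /eball /= (lt_le_trans xr).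
Qed.

Lemma psumD u v N x : psum (fun m => u m + v m) N x = psum u N x + psum v N x.
Proof. by rewrite /psum -big_split; apply: eq_bigr => m _; rewrite evD. Qed.

Lemma evN (w : U) (x : E) : ev (- w) x = - ev w x.
Proof. by rewrite -sub0r evB ev0 sub0r. Qed.

Lemma psumN u N x : psum (fun m => - u m) N x = - psum u N x.
Proof. by rewrite /psum -sumrN; apply: eq_bigr => m _; rewrite evN. Qed.

Lemma rep0 r : rep r (fun _ : E => 0 : C) (fun=> 0 : U).
Proof.
split=> [|x _ e e0]; first exact: summ0.
by exists 0%N => N _; rewrite /psum big1 => [|m _]; rewrite ?ev0 // subrr normr0 ltW.
Qed.

Lemma repD r f g u v : rep r f u -> rep r g v ->
  rep r (fun x => f x + g x) (fun m => u m + v m).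
Proof.
move=> [su hf] [sv hg]; split=> [|x xr e e0]; first exact: summD.
have e2 : 0 < e / 2 by rewrite divr_gt0.
have [N1 h1] := hf x xr _ e2; have [N2 h2] := hg x xr _ e2.
exists (maxn N1 N2) => N; rewrite geq_max => /andP[/h1 l1 /h2 l2].
rewrite psumD opprD addrACA; apply: le_trans (ler_normD _ _) _; lra.
Qed.

Lemma repN r f u : rep r f u -> rep r (fun x => - f x) (fun m => - u m).
Proof.
move=> [su hf]; split=> [|x xr e e0]; first exact: summN.
have [N1 h1] := hf x xr _ e0; exists N1 => N /h1.
by rewrite psumN -opprD normrN.
Qed.

Lemma rep_sum r (I : Type) (s : seq I) (Q : pred I) (f : I -> E -> C) (u : I -> US) :
  (forall i, Q i -> rep r (f i) (u i)) ->
  rep r (fun x => \sum_(i <- s | Q i) f i x) (fun m => \sum_(i <- s | Q i) u i m).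
Proof.
move=> h; elim: s => [|i s IH].
  have -> : (fun m => \sum_(i <- [::] | Q i) u i m) = fun=> 0.
    by apply/funext => m; rewrite big_nil.
  by apply: rep_ext (rep0 r) => x _; rewrite big_nil.
case Qi: (Q i).
  have -> : (fun m => \sum_(j <- i :: s | Q j) u j m) =
      fun m => u i m + \sum_(j <- s | Q j) u j m.
    by apply/funext => m; rewrite big_cons Qi.
  by apply: rep_ext (repD (h i Qi) IH) => x _; rewrite big_cons Qi.
have -> : (fun m => \sum_(j <- i :: s | Q j) u j m) = fun m => \sum_(j <- s | Q j) u j m.
  by apply/funext => m; rewrite big_cons Qi.
by apply: rep_ext IH => x _; rewrite big_cons Qi.
Qed.

Lemma sum_triangle (V : nmodType) (F : nat -> nat -> V) N :
  \sum_(m < N) \sum_(i < m.+1) F i (m - i)%N = \sum_(i < N) \sum_(j < N - i) F i j.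
Proof.
elim: N => [|N IH]; first by rewrite !big_ord0.
rewrite big_ord_recr /= IH [RHS]big_ord_recr /= subSnn big_ord1.
rewrite [X in _ + X]big_ord_recr /= subnn addrA -big_split; congr (_ + _).
by apply: eq_bigr => i _; rewrite subSn ?leq_ord // ?big_ord_recr //= ltnW.
Qed.

Lemma rep_mul r f g u v : rep r f u -> rep r g v ->
  rep r (fun x => f x * g x) (seqmul u v).
Proof.
move=> fu gv; split=> [|x xr e e0]; first by apply: summ_seqmul; [|case: fu|case: gv].
have r0 : 0 < r by apply: le_lt_trans xr; apply: enorm_ge0.
pose s := (enorm x + r) / 2; rewrite /eball /= in xr.
have xs : enorm x <= s by rewrite /s; lra.
have sr : 0 < s < r by have := enorm_ge0 x; rewrite /s; lra.
have [A [t1 [A0 t101 hA]]] := rep_tail n_gt0 sr fu.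
have [B [t2 [B0 t201 hB]]] := rep_tail n_gt0 sr gv.
pose t := Num.max t1 t2.
have /andP[t10 t11] := t101; have /andP[t20 t21] := t201.
have t01 : 0 <= t < 1 by rewrite le_max t10 /= gt_max t11.
have /andP[t0 _] := t01.
have lt1 k : t1 ^+ k <= t ^+ k by rewrite lerXn2r ?nnegrE // le_max lexx.
have lt2 k : t2 ^+ k <= t ^+ k by rewrite lerXn2r ?nnegrE // le_max lexx orbT.
have [hA1 hA2] := hA x xs; have [hB1 hB2] := hB x xs.
have AB0 : 0 < A * B + 1 by have := mulr_ge0 A0 B0; lra.
have [N0 hN0] := poly_geom_small 1 t01 (divr_gt0 e0 AB0).
exists N0 => N /hN0; rewrite expr1 ler_pdivlMr // => hN.
apply: le_trans hN; set D := f x * g x - _.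
have -> : D = (f x - psum u N x) * g x +
    \sum_(i < N) ev (u i) x * (g x - psum v (N - i) x).
  rewrite /D mulrBl /psum; under [\sum_(i < N) _ * (_ - _)]eq_bigr do rewrite mulrBr mulr_sumr.
  rewrite sumrB -mulr_suml addrA subrK; congr (_ - _).
  rewrite -(sum_triangle (fun i j => ev (u i) x * ev (v j) x)).
  apply: eq_bigr => m _; rewrite /seqmul ev_sum; apply: eq_bigr => i _.
  by rewrite ev_cmul.
have hg : `|g x| <= B by have := hB2 0%N; rewrite /psum big_ord0 subr0 mulr1.
apply: le_trans (ler_normD _ _) _.
apply: (@le_trans _ _ (A * B * t ^+ N + \sum_(i < N) A * B * t ^+ N)); last first.
  rewrite sumr_const card_ord -mulrS -[leLHS]mulr_natl [leLHS](_ : _ = N.+1%:R * t ^+ N *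
    (A * B)); last by ring.
  rewrite ler_wpM2l ?mulr_ge0 ?exprn_ge0 //; lra.
apply: lerD.
  rewrite cnormM mulrAC; apply: ler_pM => //.
  by apply: le_trans (hA2 N) _; rewrite ler_wpM2l.
apply: le_trans (ler_norm_sum _ _ _) _; apply: ler_sum => i _.
rewrite cnormM [leRHS](_ : _ = (A * t ^+ i) * (B * t ^+ (N - i))).
  by apply: ler_pM => //; [apply: le_trans (hA1 i) _|apply: le_trans (hB2 (N - i)%N) _];
    rewrite ler_wpM2l.
by rewrite mulrACA -exprD subnKC // ltnW.
Qed.

Lemma enormZ (c : R) (x : E) : enorm (c *: x) = `|c| * enorm x.
Proof.
rewrite /enorm -sqrtr_sqr -sqrtrM ?sqr_ge0 // mulr_sumr; congr Num.sqrt.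
by apply: eq_bigr => i _; rewrite mxE exprMn.
Qed.

Lemma ev_homZ m (w : U) c (x : E) : hom m w -> ev w (c *: x) = c ^+ m *: ev w x.
Proof.
move=> /andP[h1 h2]; rewrite /ev -cplxZ.
congr cplx; [rewrite -(meval_scale _ _ h1)|rewrite -(meval_scale _ _ h2)];
  by apply: mpoly.meval_eq => i; rewrite mxE.
Qed.

Lemma rep_eq0 r f u : 0 < r -> (forall x, eball r x -> f x = 0) -> rep r f u ->
  forall m, u m = 0.
Proof.
move=> r0 f0 fu; have [[hu _] _] := fu; elim/ltn_ind => m IH.
pose s := r / 2; have sr : 0 < s < r by rewrite /s; lra.
have [A [t [A0 t01 hA]]] := rep_tail n_gt0 sr fu.
have /andP[t0 t1] := t01; have d0 : 0 < 1 - t by rewrite subr_gt0.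
have key x : enorm x <= s -> ev (u m) x = 0.
  move=> xs; have [hA1 _] := hA x xs; apply/eqP; rewrite -normr_eq0 eq_le normr_ge0 andbT.
  apply: ler_epsP => e e0; rewrite add0r; pose c := Num.min (1 / 2) (e / (A / (1 - t) + 1)).
  have K0 : 0 < A / (1 - t) + 1 by have := divr_ge0 A0 (ltW d0); lra.
  have c0 : 0 < c by rewrite lt_min divr_gt0 //= divr_gt0.
  have c1 : c <= 1 / 2 by rewrite ge_min lexx.
  have ce : c * (A / (1 - t) + 1) <= e by rewrite -ler_pdivlMr // ge_min lexx orbT.
  have cm k : 0 <= c ^+ k by rewrite exprn_ge0 // ltW.
  have cxs : enorm (c *: x) <= s.
    rewrite enormZ gtr0_norm //; apply: le_trans xs; rewrite ler_piMl ?enorm_ge0 //; lra.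
  have [_ hc2] := hA _ cxs.
  have fc : f (c *: x) = 0 by apply: f0; rewrite /eball /=; apply: le_lt_trans cxs _;
    case/andP: sr.
  have psE : psum u m.+1 (c *: x) = c ^+ m *: ev (u m) x.
    rewrite /psum big_ord_recr /= big1 ?add0r ?(ev_homZ _ _ (hu m)) // => i _.
    by rewrite IH // ev0.
  have B1 L : `|psum u (m.+1 + L) (c *: x) - psum u m.+1 (c *: x)| <= c ^+ m.+1 * (A / (1 - t)).
    have -> : psum u (m.+1 + L) (c *: x) - psum u m.+1 (c *: x) =
        \sum_(j < L) ev (u (m.+1 + j)%N) (c *: x).
      by rewrite /psum big_split_ord /= [LHS]addrC addKr.
    apply: le_trans (ler_norm_sum _ _ _) _.
    apply: (@le_trans _ _ (\sum_(j < L) c ^+ m.+1 * A * t ^+ j)).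
      apply: ler_sum => j _; rewrite (ev_homZ _ _ (hu _)) normrZ normrX gtr0_norm //.
      rewrite exprD -!mulrA ler_wpM2l //.
      apply: (@le_trans _ _ (1 * (A * t ^+ (m.+1 + j)))).
        apply: ler_pM => //; apply: exprn_ile1 (ltW c0) _; lra.
      by rewrite mul1r ler_wpM2l //; apply: (ler_wiXn2l t0 (ltW t1)); rewrite leq_addl.
    rewrite -mulr_sumr -mulrA ler_wpM2l //.
    by rewrite ler_wpM2l // geom_sum_le.
  have B2 : `|psum u m.+1 (c *: x)| <= c ^+ m.+1 * (A / (1 - t)).
    apply: ler_epsP => e' e'0;
      have [N0 hN0] := poly_geom_small 0 t01 (divr_gt0 e'0 (ltr_wpDl A0 ltr01)).
    rewrite -[psum u m.+1 _](subrK (psum u (m.+1 + N0) (c *: x))).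
    apply: le_trans (ler_normD _ _) _; rewrite distrC lerD //.
    have := hc2 (m.+1 + N0)%N; rewrite fc sub0r normrN => /le_trans; apply.
    have := hN0 _ (leq_addl m.+1 N0); rewrite expr0 mul1r ler_pdivlMr ?ltr_wpDl //.
    apply: le_trans; rewrite mulrC ler_wpM2l ?exprn_ge0 //; lra.
  move: B2; rewrite psE normrZ normrX gtr0_norm // exprSr -mulrA ler_pM2l ?exprn_gt0 //.
  by move/le_trans; apply; apply: le_trans ce; apply: (ler_wpM2l (ltW c0)); lra.
have s0 : 0 < s by rewrite /s; lra.
apply: (pnr_eq0 n_gt0 (hu m)); apply/eqP; rewrite eq_le pnr_ge0 andbT.
rewrite -(mul0rn _ 2); apply: (pnr_le_sup n_gt0 (hu m)) => // x; rewrite mul0r.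
pose c := s / (enorm x + 1); have x1 : 0 < enorm x + 1 by have := enorm_ge0 x; lra.
have c0 : 0 < c by rewrite divr_gt0.
have : ev (u m) (c *: x) = 0.
  apply: key; rewrite enormZ gtr0_norm // /c mulrAC ler_pdivrMr //;
    apply: (ler_wpM2l (ltW s0)); lra.
rewrite (ev_homZ _ _ (hu m)) => /eqP; rewrite scaler_eq0 expf_eq0 (gt_eqF c0) andbF /=.
by move/eqP->; rewrite normr0.
Qed.

Lemma rep_inj r f u v : 0 < r -> rep r f u -> rep r f v -> u = v.
Proof.
move=> r0 fu fv; apply/funext => m; apply/eqP; rewrite -subr_eq0; apply/eqP.
apply: (rep_eq0 r0 _ (repD fu (repN fv))) => x _; exact: subrr.
Qed.

End RepOps.

Section Calculus.
Variables (R : realType) (n : nat).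
Local Notation E := 'rV[R]_n.
Local Notation C := (Rcomplex R).
Local Notation M := (mpoly.mpoly n R).
Local Notation U := (M * M)%type.
Local Notation US := (nat -> U).
Hypothesis n_gt0 : (0 < n)%N.
Implicit Types (f g : E -> C) (u v : US) (r : R) (x y : E).

Lemma geom_series_lim (a : R ^nat) (K t : R) : 0 <= t < 1 ->
  (forall m, `|a m| <= K * t ^+ m) ->
  exists l : R, forall e, 0 < e ->
    exists N0, forall N, (N0 <= N)%N -> `|l - \sum_(m < N) a m| <= e.
Proof.
move=> /andP[t0 t1] ha; have cv : cvgn (series a).
  apply: normed_cvg; apply: (series_le_cvg _ _ ha) => [m|m|].
  - exact: normr_ge0.
  - exact: le_trans (normr_ge0 _) (ha m).
  - by apply: is_cvg_geometric_series; rewrite ger0_norm.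
exists (limn (series a)) => e e0; have /cvgrPdist_le/(_ e e0)[N0 _ hN] := cv.
by exists N0 => N /hN; rewrite /series /= big_mkord.
Qed.

Lemma rep_exists r u : summ r u -> exists f, rep r f u.
Proof.
move=> su; suff /boolp.choice[f hf] : forall x, exists z : C, eball r x -> forall e, 0 < e ->
    exists N0, forall N, (N0 <= N)%N -> `|z - psum u N x| <= e by exists f.
move=> x; case: (pselect (eball r x)) => [xr|nxr]; last by exists 0.
rewrite /eball /= in xr; pose s := (enorm x + r) / 2.
have sr : 0 < s < r by have := enorm_ge0 x; rewrite /s; lra.
have xs : enorm x <= s by rewrite /s; lra.
have [K [t [K0 t01 hK]]] := summ_ev_geom n_gt0 sr su.
have [|lr hlr] := @geom_series_lim (fun m => complex.Re (ev (u m) x)) K t t01.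
  by move=> m; apply: le_trans (cnorm_Re _) (hK x xs m).
have [|li hli] := @geom_series_lim (fun m => complex.Im (ev (u m) x)) K t t01.
  by move=> m; apply: le_trans (cnorm_Im _) (hK x xs m).
exists (cplx lr li) => _ e e0; have e2 : 0 < e / 2 by rewrite divr_gt0.
have [N1 h1] := hlr _ e2; have [N2 h2] := hli _ e2.
exists (maxn N1 N2) => N; rewrite geq_max => /andP[/h1 l1 /h2 l2].
apply: le_trans (cnorm_le _) _; rewrite !raddfB /=.
rewrite [complex.Re (psum _ _ _)](raddf_sum (@complex.Re R : C -> R)).
rewrite [complex.Im (psum _ _ _)](raddf_sum (@complex.Im R : C -> R)).
lra.
Qed.

Lemma enorm_sqr x : enorm x ^+ 2 = \sum_i x 0 i ^+ 2.
Proof. by rewrite sqr_sqrtr // sumr_ge0 // => i _; rewrite sqr_ge0. Qed.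

Local Notation e_ i := (delta_mx 0 i : E).

Lemma shiftE x i (h : R) j : (h *: e_ i + x) 0 j = x 0 j + h * (j == i)%:R.
Proof. by rewrite !mxE eqxx /= addrC. Qed.

Lemma enorm_shift x i (h : R) : enorm (h *: e_ i + x) <= enorm x + `|h|.
Proof.
rewrite -ler_sqr ?nnegrE ?addr_ge0 ?enorm_ge0 // enorm_sqr.
under eq_bigr do rewrite shiftE.
have -> : \sum_j (x 0 j + h * (j == i)%:R) ^+ 2 = enorm x ^+ 2 + 2 * h * x 0 i + h ^+ 2.
  rewrite enorm_sqr (bigD1 i) //= [in RHS](bigD1 i) //= eqxx.
  rewrite (eq_bigr (fun j => x 0 j ^+ 2)); first by rewrite mulr1; ring.
  by move=> j /negbTE ->; rewrite mulr0 addr0.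
have xi : `|x 0 i| <= enorm x.
  rewrite -ler_sqr ?nnegrE ?enorm_ge0 // real_normK ?num_real // enorm_sqr (bigD1 i) //=.
  by rewrite lerDl sumr_ge0 // => j _; rewrite sqr_ge0.
rewrite sqrrD real_normK ?num_real // lerD2r lerD2l -[leRHS]mulr_natl -[leLHS]mulrA.
rewrite ler_pM2l // [leRHS]mulrC; apply: le_trans (ler_norm _) _.
by rewrite normrM ler_wpM2l.
Qed.

Lemma ev_second_order (w : U) x i (h K : R) :
  (forall t, `|t| <= `|h| -> `|ev (pderiv i (pderiv i w)) (t *: e_ i + x)| <= K) ->
  `|ev w (h *: e_ i + x) - ev w x - h *: ev (pderiv i w) x| <= (K * h ^+ 2) *+ 2.
Proof.
move=> hK; have S (q : M) t : mpoly.meval ((t *: e_ i + x) 0) q =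
    mpoly.meval (fun j => x 0 j + t * (j == i)%:R) q.
  by apply: mpoly.meval_eq => j; rewrite shiftE.
apply: le_trans (cnorm_le _) _; rewrite mulr2n /ev -cplxZ -!cplxB /= !S.
apply: lerD; apply: meval_second_order => t /hK; apply: le_trans.
  by apply: le_trans (cnorm_Re _); rewrite /ev /= S.
by apply: le_trans (cnorm_Im _); rewrite /ev /= S.
Qed.

Lemma pderiv_hom0 i (w : U) : hom 0 w -> pderiv i w = 0.
Proof. by move=> /andP[h1 h2]; rewrite /pderiv !mderiv_homog0. Qed.

Lemma ev_pderiv0 i x : ev (pderiv i (0 : U)) x = 0.
Proof. by rewrite /pderiv /ev /= !mpoly.mderiv0 !mpoly.meval0. Qed.

Lemma rep_quotient r f g u i x : rep r f u -> rep r g (seqd i u) -> eball r x ->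
  exists K eta, [/\ 0 <= K, 0 < eta & forall h : R, `|h| <= eta ->
    `|f (h *: e_ i + x) - f x - h *: g x| <= K * h ^+ 2].
Proof.
move=> fu gu; rewrite /eball /= => xr; pose s := (enorm x + r) / 2.
have sr : 0 < s < r by have := enorm_ge0 x; rewrite /s; lra.
have xs : enorm x <= s by rewrite /s; lra.
have hu := fu.1.1.
have [A [t1 [A0 t101 hA]]] := rep_tail n_gt0 sr fu.
have [B [t2 [B0 t201 hB]]] := rep_tail n_gt0 sr gu.
have [D [t3 [D0 t301 hD]]] := summ_ev_geom n_gt0 sr (summ_seqd n_gt0 i
  (summ_seqd n_gt0 i fu.1)).
exists ((D / (1 - t3)) *+ 2), (s - enorm x); split.
- by rewrite mulrn_wge0 // divr_ge0 // subr_ge0 ltW //; case/andP: t301.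
- by rewrite /s; lra.
move=> h hs; have ys t : `|t| <= `|h| -> enorm (t *: e_ i + x) <= s.
  by move=> th; apply: le_trans (enorm_shift _ _ _) _; lra.
set y := h *: e_ i + x; have ysh : enorm y <= s by apply: ys.
have main N : `|psum u N.+2 y - psum u N.+2 x - h *: psum (seqd i u) N.+1 x| <=
    (D / (1 - t3)) *+ 2 * h ^+ 2.
  have -> : psum u N.+2 y - psum u N.+2 x - h *: psum (seqd i u) N.+1 x =
      \sum_(m < N.+2) (ev (u m) y - ev (u m) x - h *: ev (pderiv i (u m)) x).
    rewrite !sumrB; congr (_ - _); rewrite -scaler_sumr; congr (_ *: _).
    by rewrite [RHS]big_ord_recl /= (pderiv_hom0 i (hu 0%N)) ev0 add0r.
  have Z m : (m < 2)%N -> `|ev (u m) y - ev (u m) x - h *: ev (pderiv i (u m)) x| <= 0.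
    move=> m2; rewrite -[leRHS](mul0rn _ 2) -(mul0r (h ^+ 2)).
    apply: ev_second_order => t th; rewrite (_ : ev _ _ = 0) ?normr0 //.
    case: m m2 => [|[|//]] _; first by rewrite (pderiv_hom0 i (hu 0%N)) ev_pderiv0.
    by rewrite (pderiv_hom0 i (hom_pderiv i (hu 1%N))) ev0.
  rewrite 2!big_ord_recl /=.
  apply: le_trans (ler_normD _ _) _; rewrite -[leRHS]add0r; apply: lerD; first exact: Z.
  apply: le_trans (ler_normD _ _) _; rewrite -[leRHS]add0r; apply: lerD; first exact: Z.
  apply: le_trans (ler_norm_sum _ _ _) _.
  apply: (@le_trans _ _ (\sum_(m < N) ((D * t3 ^+ m) * h ^+ 2) *+ 2)).
    apply: ler_sum => m _; by apply: ev_second_order => t /ys zs; apply: (hD _ zs m).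
  rewrite sumrMnl -mulr_suml -mulr_sumr mulrnAl lerMn2r /= ler_wpM2r ?sqr_ge0 //.
  by rewrite ler_wpM2l // geom_sum_le.
apply: ler_epsP => e e0.
have h1 : 0 < 1 + `|h| + 1 by have := normr_ge0 h; lra.
have small K t : 0 <= K -> 0 <= t < 1 -> exists N0, forall N, (N0 <= N)%N ->
    K * t ^+ N <= e / (3 * (1 + `|h|)).
  move=> K0 t01; have K1 : 0 < K + 1 by lra.
  have e3 : 0 < e / (3 * (1 + `|h|)) by rewrite divr_gt0 // mulr_gt0 //; have := normr_ge0 h;
    lra.
  have [N0 hN] := poly_geom_small 0 t01 (divr_gt0 e3 K1).
  exists N0 => N /hN; rewrite mul1r ler_pdivlMr //; apply: le_trans.
  by rewrite mulrC ler_wpM2l ?exprn_ge0 //; [case/andP: t01|lra].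
have [N1 hN1] := small _ _ A0 t101; have [N2 hN2] := small _ _ B0 t201.
pose N := maxn N1 N2.
have [_ ay] := hA y ysh; have [_ ax] := hA x xs; have [_ bx] := hB x xs.
have l1 : `|f y - psum u N.+2 y| <= e / (3 * (1 + `|h|)).
  by apply: le_trans (ay _) _; apply: hN1; rewrite /N !leqW // leq_maxl.
have l2 : `|f x - psum u N.+2 x| <= e / (3 * (1 + `|h|)).
  by apply: le_trans (ax _) _; apply: hN1; rewrite /N !leqW // leq_maxl.
have l3 : `|g x - psum (seqd i u) N.+1 x| <= e / (3 * (1 + `|h|)).
  by apply: le_trans (bx _) _; apply: hN2; rewrite /N leqW // leq_maxr.
have -> : f y - f x - h *: g x = (psum u N.+2 y - psum u N.+2 x - h *: psum (seqd i u) N.+1 x) +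
   ((f y - psum u N.+2 y) - (f x - psum u N.+2 x) - h *: (g x - psum (seqd i u) N.+1 x)).
  move: (psum u N.+2 y) (psum u N.+2 x) (psum (seqd i u) N.+1 x) => a b c.
  rewrite scalerBr; move: (f y) (f x) (h *: g x) (h *: c) => a' b' d' d.
  by apply/eqP; rewrite -subr_eq0; apply/eqP; ring.
apply: le_trans (ler_normD _ _) _; apply: lerD; first exact: main.
apply: le_trans (ler_normB _ _) _; apply: le_trans (lerD (ler_normB _ _) (lexx _)) _.
rewrite normrZ; have h0 := normr_ge0 h.
have {l3}l3 := ler_wpM2l h0 l3; set w := e / _ in l1 l2 l3.
have w0 : 0 <= w by apply: le_trans l1.
have h3 : 0 < 3 * (1 + `|h|) by rewrite mulr_gt0 //; lra.
have we : w * (3 * (1 + `|h|)) = e by rewrite /w divfK // gt_eqF.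
apply: le_trans (lerD (lerD l1 l2) l3) _; rewrite -we.
rewrite (_ : w + w + `|h| * w = w * (2 + `|h|)); last by ring.
by rewrite ler_wpM2l //; lra.
Qed.

End Calculus.

Section Derivatives.
Variables (R : realType) (n : nat).
Local Notation E := 'rV[R]_n.
Local Notation C := (Rcomplex R).
Local Notation M := (mpoly.mpoly n R).
Local Notation U := (M * M)%type.
Local Notation US := (nat -> U).
Hypothesis n_gt0 : (0 < n)%N.
Implicit Types (f g : E -> C) (u v : US) (r : R) (x y : E).
Local Notation e_ i := (delta_mx 0 i : E).

Lemma quotient_cvg f (z : C) x i (K eta : R) : 0 <= K -> 0 < eta ->
  (forall h : R, `|h| <= eta -> `|f (h *: e_ i + x) - f x - h *: z| <= K * h ^+ 2) ->
  (fun h : R => h^-1 *: ((f \o shift x) (h *: e_ i) - f x)) @ 0^' --> z.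
Proof.
move=> K0 eta0 hf; apply/cvgrPdist_le => e e0.
have K1 : 0 < K + 1 by lra.
near=> h; have h0 : h != 0 by near: h; exact: nbhs_dnbhs_neq.
have hd : `|h| < Num.min eta (e / (K + 1)).
  near: h; apply: dnbhs0_lt; by rewrite lt_min eta0 divr_gt0.
have [/ltW h1 /ltW h2] : `|h| < eta /\ `|h| < e / (K + 1) by apply/andP; rewrite -lt_min.
rewrite distrC /= /shift /= -[X in _ - X]scale1r -(mulVf h0) -scalerA -scalerBr normrZ normfV.
rewrite mulrC ler_pdivrMr ?normr_gt0 //; apply: le_trans (hf h h1) _.
rewrite -real_normK ?num_real // expr2 mulrA ler_wpM2r //.
by move: h2; rewrite ler_pdivlMr // => h2; have := normr_ge0 h; lra.
Unshelve. all: by end_near. Qed.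

Lemma rep_partial_cvg r f g u i x : rep r f u -> rep r g (seqd i u) -> eball r x ->
  (fun h : R => h^-1 *: ((f \o shift x) (h *: e_ i) - f x)) @ 0^' --> g x.
Proof.
move=> fu gu xr; have [K [eta [K0 eta0 h]]] := rep_quotient n_gt0 fu gu xr.
exact: quotient_cvg h.
Qed.

Lemma rep_derivable r f u i x : rep r f u -> eball r x -> derivable f x (e_ i).
Proof.
move=> fu xr; have [g gu] := rep_exists n_gt0 (summ_seqd n_gt0 i fu.1).
by apply/cvg_ex; exists (g x); apply: rep_partial_cvg fu gu xr.
Qed.

Lemma rep_partial r f u i : rep r f u -> rep r (partial i f) (seqd i u).
Proof.
move=> fu; have [g gu] := rep_exists n_gt0 (summ_seqd n_gt0 i fu.1).
apply: rep_ext (gu) => x xr; apply/esym/cvg_lim; first exact: norm_hausdorff.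
exact: rep_partial_cvg fu gu xr.
Qed.

Lemma meval_continuous (p : M) : continuous (fun x : E => mpoly.meval (x 0) p).
Proof.
have -> : (fun x : E => mpoly.meval (x 0) p) =
    fun x : E => \sum_(m <- mpoly.msupp p) mpoly.mcoeff m p * \prod_i x 0 i ^+ m i.
  by apply/funext => x; rewrite mpoly.mevalE.
apply: (@continuous_big R _ +%R 0 xpredT (@add_continuous R^o)) => m _ x.
apply: (@continuousM R E (fun=> mpoly.mcoeff m p) (fun y : E => \prod_i y 0 i ^+ m i)).
  exact: cst_continuous.
apply: (@continuous_big R _ *%R 1 xpredT (@mul_continuous R)) => i _ {}x.
 apply: (@continuous_comp _ _ _ (fun y : E => y 0 i) (fun t : R => t ^+ m i)).
  exact: coord_continuous.
exact: exprn_continuous.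
Qed.

Lemma enorm_continuous : continuous (@enorm R n).
Proof.
move=> x; rewrite (_ : @enorm R n = Num.sqrt \o (fun x : E => mpoly.meval (x 0) (rad2 R n))).
  by apply: continuous_comp; [exact: meval_continuous|exact: sqrt_continuous].
by apply/funext => y /=; rewrite sqrt_rad2.
Qed.

Lemma nbhs_eball r x : eball r x -> \forall y \near x, eball r y.
Proof.
by move=> xr; exact: (@enorm_continuous x _ (lt_nbhsl xr)).
Qed.

Lemma ev_near (w : U) x e : 0 < e -> \forall y \near x, `|ev w x - ev w y| <= e.
Proof.
move=> e0; have e2 : 0 < e / 2 by rewrite divr_gt0.
have /cvgrPdist_le/(_ _ e2) h1 := @meval_continuous w.1 x.
have /cvgrPdist_le/(_ _ e2) h2 := @meval_continuous w.2 x.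
near=> y; apply: le_trans (cnorm_le _) _; rewrite /ev -cplxB /=.
have l1 : `|mpoly.meval (x 0) w.1 - mpoly.meval (y 0) w.1| <= e / 2 by near: y.
have l2 : `|mpoly.meval (x 0) w.2 - mpoly.meval (y 0) w.2| <= e / 2 by near: y.
by lra.
Unshelve. all: by end_near. Qed.

Lemma psum_near u N x e : 0 < e -> \forall y \near x, `|psum u N x - psum u N y| <= e.
Proof.
move=> e0; elim: N e e0 => [|N IH] e e0.
  by near=> y; rewrite /psum !big_ord0 subrr normr0 ltW.
have e2 : 0 < e / 2 by rewrite divr_gt0.
near=> y; rewrite /psum !big_ord_recr /= opprD addrACA.
apply: le_trans (ler_normD _ _) _.
have l1 : `|psum u N x - psum u N y| <= e / 2 by near: y; apply: IH.
have l2 : `|ev (u N) x - ev (u N) y| <= e / 2 by near: y; apply: ev_near.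
by rewrite /psum in l1; lra.
Unshelve. all: by end_near. Qed.

Lemma rep_continuous r f u x : rep r f u -> eball r x -> {for x, continuous f}.
Proof.
move=> fu xr; apply: (@cvgrPdist_le _ _ _ (nbhs x) (nbhs_filter x) f (f x)).2 => e e0.
have xr' := xr; rewrite /eball /= in xr'; pose s := (enorm x + r) / 2.
have sr : 0 < s < r by have := enorm_ge0 x; rewrite /s; lra.
have xs : enorm x < s by rewrite /s; lra.
have [A [t [A0 t01 hA]]] := rep_tail n_gt0 sr fu; have /andP[t0 _] := t01.
have A1 : 0 < A + 1 by lra.
have e3 : 0 < e / 3 by rewrite divr_gt0.
have [N /(_ N (leqnn N))] := poly_geom_small 0 t01 (divr_gt0 e3 A1).
rewrite mul1r ler_pdivlMr // => hN.
have small z : enorm z <= s -> `|f z - psum u N z| <= e / 3.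
  move=> /hA[_ /(_ N)] h; apply: le_trans h _; apply: le_trans hN.
  by rewrite mulrC ler_wpM2l ?exprn_ge0 // lerDl.
near=> y; have ys : enorm y <= s by apply: ltW; near: y; apply: nbhs_eball.
have l1 := small _ (ltW xs); have l2 := small _ ys.
have l3 : `|psum u N x - psum u N y| <= e / 3 by near: y; apply: psum_near.
have -> : f x - f y = (f x - psum u N x) + (psum u N x - psum u N y) - (f y - psum u N y).
  by rewrite subrKA opprB addrA subrK.
apply: le_trans (ler_normB _ _) _; apply: le_trans (lerD (ler_normD _ _) (lexx _)) _.
lra.
Unshelve. all: by end_near. Qed.

Lemma rep_iter_partial r f u i k : rep r f u -> rep r (iter k (partial i) f) (iter k
  (seqd i) u).
Proof. by move=> fu; elim: k => //= k IH; apply: rep_partial. Qed.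

Lemma rep_foldr_partial r f u s : rep r f u -> rep r (foldr (@partial R n) f s) (foldr
  (@seqd R n) u s).
Proof. by move=> fu; elim: s => //= i s IH; apply: rep_partial. Qed.

Lemma rep_smooth r f u : rep r f u -> smooth_on (eball r) f.
Proof.
move=> fu s x xr; split=> [|i].
  by apply: rep_continuous (rep_foldr_partial s fu) xr.
exact: rep_derivable (rep_foldr_partial s fu) xr.
Qed.

Lemma rep_laplacian r f u : rep r f u -> rep r (laplacian f) (seqlap u).
Proof. by move=> fu; apply: rep_sum => // i _; do 2 apply: rep_partial. Qed.

Lemma rep_iter_laplacian r f u k : rep r f u ->
  rep r (iter k (@laplacian R n) f) (iter k (@seqlap R n) u).
Proof. by move=> fu; elim: k => //= k IH; apply: rep_laplacian. Qed.

Lemma rep_Dmulti r f u alpha : rep r f u -> rep r (Dmulti alpha f) (seqdm alpha u).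
Proof.
move=> fu; rewrite /Dmulti /seqdm; elim: (enum _) => //= i s IH.
exact: rep_iter_partial.
Qed.

Lemma rep_ev0 r f u : 0 < r -> rep r f u -> f 0 = ev (u 0%N) 0.
Proof.
move=> r0 [[hu _] hf]; apply/eqP; rewrite -subr_eq0 -normr_eq0 eq_le normr_ge0 andbT.
have z0 : enorm (0 : E) = 0.
  by rewrite /enorm big1 ?sqrtr0 // => i _; rewrite mxE expr0n.
apply: ler_epsP => e e0; rewrite add0r; have [|N0 hN] := hf 0 _ e e0.
  by rewrite /eball /= z0.
have := hN N0.+1 (leqnSn _); rewrite /psum big_ord_recl /= big1 ?addr0 // => m _.
have /andP[h1 h2] := hu (bump 0 m); rewrite /ev.
have Z (q : M) : q \is mpoly.ishomog1 (bump 0 m) (@mpoly.mdeg n) -> mpoly.meval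
  ((0 : E) 0) q = 0.
  move=> /meval0_homog <-; apply: mpoly.meval_eq => i; by rewrite mxE.
by rewrite !Z.
Qed.

End Derivatives.

Section AnalyticBall.
Variables (R : realType) (n : nat).
Local Notation E := 'rV[R]_n.
Local Notation C := (Rcomplex R).
Local Notation M := (mpoly.mpoly n R).
Local Notation U := (M * M)%type.
Local Notation US := (nat -> U).
Hypothesis n_gt0 : (0 < n)%N.
Implicit Types (f g : E -> C) (u v : US) (r : R) (x y : E).

Lemma taylor_poly f m : exists w : U, hom m w /\ forall x, ev w x = taylor f m x.
Proof.
have [p1 [h1 c1]] := homog_of_coefs m
  (fun alpha => (mfact alpha)%:R^-1 * complex.Re (Dmulti alpha f 0)).
have [p2 [h2 c2]] := homog_of_coefs m
  (fun alpha => (mfact alpha)%:R^-1 * complex.Im (Dmulti alpha f 0)).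
exists (p1, p2); split=> [|x]; first by apply/andP.
have cE (z : C) : z = cplx (complex.Re z) (complex.Im z) by case: z.
have ReZ (t : R) (z : C) : complex.Re (t *: z) = t * complex.Re z by case: z.
have ImZ (t : R) (z : C) : complex.Im (t *: z) = t * complex.Im z by case: z.
rewrite /ev (meval_homog _ h1) (meval_homog _ h2) [RHS]cE /taylor.
rewrite [complex.Re _](raddf_sum (@complex.Re R : C -> R)).
rewrite [complex.Im _](raddf_sum (@complex.Im R : C -> R)).
congr cplx; apply: eq_bigr => alpha /eqP am.
  by rewrite /= ReZ c1 // mulrAC.
by rewrite /= ImZ c2 // mulrAC.
Qed.

Lemma rep_taylor r f u m x : 0 < r -> rep r f u -> taylor f m x = ev (u m) x.
Proof.
move=> r0 fu; have /andP[h1 h2] := fu.1.1 m.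
have D (alpha : mpoly.multinom n) : mpoly.mdeg alpha = m -> Dmulti alpha f 0 =
    (mfact alpha)%:R *: cplx (mpoly.mcoeff alpha (u m).1) (mpoly.mcoeff alpha (u m).2).
  move=> am; rewrite (rep_ev0 r0 (rep_Dmulti n_gt0 alpha fu)) seqdmE add0n am /ev -cplxZ /=.
  have Z (q : M) : mpoly.meval ((0 : E) 0) (mpoly.mderivm alpha q) =
    (mfact alpha)%:R * mpoly.mcoeff alpha q.
    rewrite mulr_natl -mcoeff0_mderivm -mevalf0.
    by apply: mpoly.meval_eq => i; rewrite mxE.
  by rewrite !Z.
rewrite /taylor /ev (meval_homog _ h1) (meval_homog _ h2).
rewrite (eq_bigr (fun alpha : mpoly.bmultinom n m.+1 =>
    cplx (mpoly.mcoeff alpha (u m).1 * mpow x alpha) (mpoly.mcoeff alpha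
      (u m).2 * mpow x alpha))).
  rewrite -[RHS]/(_ : C); apply/esym; elim/big_rec3: _ => // alpha a b z _ <-.
  by rewrite cplxD.
move=> alpha /eqP am; rewrite (D _ am) scalerA mulrAC mulVf ?mul1r.
  by rewrite -cplxZ !(mulrC (mpow x alpha)).
rewrite pnatr_eq0 -lt0n /mfact; apply: prodn_gt0 => i; exact: fact_gt0.
Qed.

Lemma compact_eball r (K : set E) : 0 < r -> compact K -> K `<=` eball r ->
  exists2 s, 0 < s < r & forall x, K x -> enorm x <= s.
Proof.
move=> r0 /compact_near_coveringP cK Kr.
have /= H := cK R (r^'-) (fun s x => enorm x < s) _.
have {}H : \forall s \near r^'-, K `<=` (fun x => enorm x < s).
  apply: H => x Kx; have := Kr _ Kx; rewrite /eball /= => xr.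
  pose c := (enorm x + r) / 2; have xc : eball c x by rewrite /eball /= /c; lra.
  exists (eball c, [set s | c < s]) => /=.
    split; first exact: nbhs_eball.
    by apply: nbhs_left_gt; rewrite /c; lra.
  by move=> [y s] /= [yc cs]; apply: lt_trans cs.
near r^'- => s; exists s.
  apply/andP; split; first by near: s; exact: nbhs_left_gt.
  by near: s; exact: nbhs_left_lt.
move=> x Kx; apply/ltW; suff : K `<=` (fun x => enorm x < s) by apply.
by near: s.
Unshelve. all: by end_near. Qed.

Lemma closed_eball_compact (s : R) : compact [set x : E | enorm x <= s].
Proof.
apply: bounded_closed_compact.
  exists s; split; first exact: num_real.
  move=> t st x /= xs; apply: le_trans (ltW st).
  rewrite /Num.norm /= mx_normrE; apply/bigmax_leP; split=> [|[i j] _ /=].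
    exact: le_trans (enorm_ge0 x) xs.
  apply: le_trans xs; rewrite ord1 -ler_sqr ?nnegrE ?enorm_ge0 // enorm_sqr.
  rewrite real_normK ?num_real // (bigD1 j) //= lerDl sumr_ge0 // => k _.
  exact: sqr_ge0.
apply: (@closed_comp _ _ _ [set t | t <= s]).
  by move=> x _; apply: enorm_continuous.
exact: closed_le.
Qed.

Lemma uniform_cvgP (K : set E) (F : nat -> E -> C) f :
  {uniform K, F @ \oo --> f} <->
  forall e, 0 < e -> exists N0, forall N, (N0 <= N)%N -> forall x, K x -> `|f x - F N x| < e.
Proof.
split=> [cv e e0|h].
  have /cv[N0 _ hN] : nbhs (f : {uniform` K -> C}) [set g | forall y, K y -> ball (f y) e
    (g y)].
    apply/uniform_nbhs; exists [set xy | ball xy.1 e xy.2]; split=> //.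
    by rewrite -entourage_from_ballE; exists e.
  by exists N0 => N /hN /= hb x /hb; rewrite -ball_normE.
move=> P /uniform_nbhs[A []]; rewrite -entourage_from_ballE => -[e /= e0 eA] AP.
have [N0 hN] := h e e0; exists N0 => // N /= /hN H; apply: AP => y Ky.
by apply: eA; rewrite /= -ball_normE; apply: H.
Qed.

Lemma rep_analytic r f u : 0 < r -> (forall x, ~ eball r x -> f x = 0) ->
  rep r f u -> analytic_ball r f.
Proof.
move=> r0 f0 fu; split=> // [|K cK Kr]; first exact: rep_smooth fu.
have [s sr Ks] := compact_eball r0 cK Kr.
have [A [t [A0 t01 hA]]] := rep_tail n_gt0 sr fu; have /andP[t0 t1] := t01.
have psE N x : series (fun m => taylor f m x) N = psum u N x.
  by rewrite /series /= big_mkord; apply: eq_bigr => m _; apply: rep_taylor r0 fu.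
split=> [x /Ks xs|].
  have [hx _] := hA x xs; apply: (@series_le_cvg _ _ (fun m => A * t ^+ m)).
  - by move=> m; apply: normr_ge0.
  - by move=> m; rewrite mulr_ge0 // exprn_ge0.
  - by move=> m; rewrite (rep_taylor m x r0 fu).
  - by apply: is_cvg_geometric_series; rewrite ger0_norm.
apply/uniform_cvgP => e e0; have e2 : 0 < e / 2 by rewrite divr_gt0.
have A1 : 0 < A + 1 by lra.
have [N0 hN0] := poly_geom_small 0 t01 (divr_gt0 e2 A1).
exists N0 => N /hN0; rewrite mul1r ler_pdivlMr // => hN x /Ks xs.
have [_ /(_ N)] := hA x xs; rewrite psE => h; apply: (@le_lt_trans _ _ (e / 2)); last by lra.
apply: le_trans h _; apply: le_trans hN.
by rewrite mulrC ler_wpM2l ?exprn_ge0 // lerDl.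
Qed.

Lemma analytic_rep r f : 0 < r -> analytic_ball r f -> exists u, rep r f u.
Proof.
move=> r0 [f0 _ fK]; have [u hu] := boolp.choice (taylor_poly f).
have hom_u m : hom m (u m) by case: (hu m).
have ev_u m x : ev (u m) x = taylor f m x by case: (hu m).
have psE N x : series (fun m => taylor f m x) N = psum u N x.
  by rewrite /series /= big_mkord; apply: eq_bigr => m _; rewrite ev_u.
have cv s : s < r -> forall e, 0 < e -> exists N0, forall N, (N0 <= N)%N ->
    forall x, enorm x <= s -> `|f x - psum u N x| < e.
  move=> sr e e0; have [|_] := fK [set x | enorm x <= s] (@closed_eball_compact s).
    by move=> x /= xs; apply: le_lt_trans sr.
  move=> /uniform_cvgP/(_ e e0)[N0 hN]; exists N0 => N NN x xs.
  by have := hN N NN x xs; rewrite psE.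
exists u; split; last first.
  move=> x xr e e0; have [N0 hN] := cv (enorm x) xr e e0.
  by exists N0 => N NN; apply/ltW/hN.
split=> // s /andP[s0 sr]; have [N0 hN] := cv s sr 1 ltr01.
have big m : (N0 <= m)%N -> pnr m (u m) * s ^+ m <= 4.
  move=> Nm; have bnd x : enorm x <= s -> `|ev (u m) x| <= 2.
    move=> xs; have h1 := hN m Nm x xs; have h2 := hN m.+1 (leqW Nm) x xs.
    have -> : ev (u m) x = (f x - psum u m x) - (f x - psum u m.+1 x).
      rewrite {2}/psum big_ord_recr -/(psum u m x) /=.
      move: (f x) (psum u m x) (ev (u m) x) => a b c.
      by apply/eqP; rewrite -subr_eq0; apply/eqP; ring.
    apply: le_trans (ler_normB _ _) _; lra.
  rewrite -ler_pdivlMr ?exprn_gt0 //.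
  have -> : 4 / s ^+ m = (2 / s ^+ m) *+ 2 by rewrite -mulrnAl; congr (_ / _); ring.
  apply: (pnr_le_sup n_gt0 (hom_u m)); first by rewrite divr_ge0 // exprn_ge0 // ltW.
  move=> x; have [x0|nx0] := eqVneq (enorm x) 0.
    have sm : 0 < s ^+ m by rewrite exprn_gt0.
    have := bnd x; rewrite x0 => /(_ (ltW s0)).
    case: m {Nm bnd} sm => [|m] sm; first by rewrite !expr0 divr1 mulr1.
    move=> _; rewrite expr0n /= mulr0; apply: le_trans (ev_norm n_gt0 x (hom_u m.+1)) _.
    by rewrite x0 expr0n /= mulr0.
  have x0 : 0 < enorm x by rewrite lt_def nx0 enorm_ge0.
  pose c := s / enorm x; have c0 : 0 < c by rewrite divr_gt0.
  have := bnd (c *: x); rewrite enormZ gtr0_norm // /c divfK // lexx => /(_ isT).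
  rewrite (ev_homZ _ _ (hom_u m)) normrZ normrX gtr0_norm // expr_div_n.
  rewrite mulrAC ler_pdivrMr ?exprn_gt0 // mulrC -ler_pdivlMr ?exprn_gt0 //.
  by rewrite mulrAC.
exists (4 + \sum_(m < N0) pnr m (u m) * s ^+ m).
  rewrite addr_ge0 // sumr_ge0 // => m _; rewrite mulr_ge0 ?pnr_ge0 // exprn_ge0 //.
  exact: ltW.
have S0 (Q : pred 'I_N0) : 0 <= \sum_(m < N0 | Q m) pnr m (u m) * s ^+ m.
  by apply: sumr_ge0 => m _; rewrite mulr_ge0 ?pnr_ge0 // exprn_ge0 // ltW.
move=> m; have [/big h|mN] := leqP N0 m.
  by apply: le_trans h _; rewrite lerDl (S0 xpredT).
rewrite (bigD1 (Ordinal mN)) //=.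
have := S0 (fun i => i != Ordinal mN); lra.
Qed.

End AnalyticBall.

Section Operator.
Variables (R : realType) (n : nat).
Local Notation E := 'rV[R]_n.
Local Notation C := (Rcomplex R).
Local Notation M := (mpoly.mpoly n R).
Local Notation U := (M * M)%type.
Local Notation US := (nat -> U).
Hypothesis n_gt0 : (0 < n)%N.
Implicit Types (f g q : E -> C) (u v w : US) (r : R) (x y : E).

Lemma rep_seq1 r k (w : U) : hom k w -> rep r (ev w) (seq1 k w).
Proof.
move=> hw; split=> [|x _ e e0]; first exact: summ_seq1.
exists k.+1 => N kN; rewrite /psum (bigD1 (Ordinal kN)) //= big1 ?addr0.
  by rewrite /seq1 eqxx subrr normr0 ltW.
move=> i ik; rewrite /seq1; case: eqP => [E|_]; last exact: ev0.
by case/eqP: ik; apply: val_inj.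
Qed.

Lemma rep_pmul r p (P : M) q w : P \is mpoly.ishomog1 (2 * p) (@mpoly.mdeg n) ->
  rep r q w -> rep r (pmul P q) (seqP p P w).
Proof.
move=> hP qw; apply: rep_ext (rep_mul n_gt0 (rep_seq1 r (homP0 hP)) qw) => x _.
rewrite /ev /= mpoly.meval0 /pmul; case: (q x) => a b.
by rewrite /cplx /GRing.mul /GRing.scale /= !mul0r subr0 addr0.
Qed.

Lemma rep_diffop r p k0 (P : M) (a : mpoly.multinom n -> E -> C)
    (s : mpoly.multinom n -> US) q w :
  P \is mpoly.ishomog1 (2 * p) (@mpoly.mdeg n) ->
  (forall alpha, (mpoly.mdeg alpha <= k0)%N -> rep r (a alpha) (s alpha)) ->
  rep r q w -> rep r (diffop p k0 a (pmul P q)) (seqL p k0 P s w).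
Proof.
move=> hP ha qw; have Pq := rep_pmul hP qw.
apply: repD => //; first exact: rep_iter_laplacian.
apply: rep_sum => // alpha _; apply: rep_mul => //; last exact: rep_Dmulti.
exact/ha/bdeg.
Qed.

Lemma rep_fun_unique r f g u : rep r f u -> rep r g u -> forall x, eball r x -> f x = g x.
Proof.
move=> [_ hf] [_ hg] x xr; apply/eqP; rewrite -subr_eq0 -normr_eq0 eq_le normr_ge0 andbT.
apply: ler_epsP => e e0; rewrite add0r; have e2 : 0 < e / 2 by rewrite divr_gt0.
have [N1 h1] := hf x xr _ e2; have [N2 h2] := hg x xr _ e2.
have l1 := h1 _ (leq_maxl N1 N2); have l2 := h2 _ (leq_maxr N1 N2).
rewrite -(subrKA (psum u (maxn N1 N2) x)); apply: le_trans (ler_normD _ _) _.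
rewrite [X in _ + X]distrC; lra.
Qed.

Lemma patch_in r f x : eball r x -> patch (fun=> 0) (eball r) f x = f x.
Proof. by move=> xr; rewrite patchT // inE. Qed.

Lemma patch_out r f x : ~ eball r x -> patch (fun=> 0) (eball r) f x = 0.
Proof. by move=> xr; rewrite patchC // inE. Qed.

Lemma rep_patch r f u : 0 < r -> rep r f u -> analytic_ball r (patch (fun=> 0) (eball r) f).
Proof.
move=> r0 fu; apply: (@rep_analytic _ _ n_gt0 _ _ u r0); first exact: patch_out.
by apply: rep_ext fu => x xr; rewrite patch_in.
Qed.

Lemma analytic_eq r f g u : analytic_ball r f -> analytic_ball r g ->
  rep r f u -> rep r g u -> f = g.
Proof.
move=> [f0 _ _] [g0 _ _] fu gu; apply/funext => x.
case: (pselect (eball r x)) => [xr|xr]; first exact: rep_fun_unique fu gu x xr.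
by rewrite f0 // g0.
Qed.

End Operator.

Theorem theorem3 (R : realType) (n p : nat) (n_ge1 : (1 <= n)%N)
    (p_ge1 : (1 <= p)%N) (P : mpoly.mpoly n R)
    (P_homog : P \is mpoly.ishomog1 (2 * p) (@mpoly.mdeg n))
    (P_elliptic : elliptic P (2 * p))
    (k0 : nat) (k0_le : (k0 <= p)%N) (rho : R) (rho_gt0 : 0 < rho)
    (a : mpoly.multinom n -> 'rV[R]_n -> Rcomplex R)
    (a_analytic : forall alpha, (mpoly.mdeg alpha <= k0)%N ->
       analytic_ball rho (a alpha)) :
  ((k0 < p)%N ->
     set_bij (analytic_ball rho) (analytic_ball rho)
       (fun q => patch (fun=> 0) (eball rho) (diffop p k0 a (pmul P q)))) /\
  (k0 = p ->
     exists r : R, [/\ 0 < r, r <= rho &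
       forall f, analytic_ball rho f ->
         exists! q, analytic_ball r q /\
           forall x, eball r x -> diffop p k0 a (pmul P q) x = f x]).
Proof.
have [delta delta_gt0 P_ge0] := P_elliptic.
have P_ge (x : 'I_n -> R) : delta * mpoly.meval x (rad2 R n ^+ p) <= mpoly.meval x P.
  have /= := P_ge0 (\row_i x i).
  have xE : (\row_i x i) (0 : 'I_1) =1 x by move=> i; rewrite mxE.
  rewrite exprM -sqrt_rad2 sqr_sqrtr ?meval_rad2_ge0 // !(mpoly.meval_eq _ xE).
  by rewrite rmorphXn.
have [s hs] : exists s, forall alpha, (mpoly.mdeg alpha <= k0)%N -> rep rho (a alpha) (s alpha).
  have /boolp.choice[s hs] : forall alpha, exists u, (mpoly.mdeg alpha <= k0)%N -> rep rho
    (a alpha) u.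
    move=> alpha; have [al|al] := leqP (mpoly.mdeg alpha) k0; last by exists (fun=> 0).
    by have [u hu] := analytic_rep n_ge1 rho_gt0 (a_analytic _ al); exists u.
  by exists s.
have s_homs alpha : (mpoly.mdeg alpha <= k0)%N -> homs (s alpha) by move=> /hs[[]].
have s_summ alpha : (mpoly.mdeg alpha <= k0)%N -> summ rho (s alpha) by move=> /hs[].
have hs_le r alpha : r <= rho -> (mpoly.mdeg alpha <= k0)%N -> rep r (a alpha) (s alpha).
  by move=> rr /hs; apply: rep_le.
have inj := @seqL_inj R n n_ge1 p k0 P delta p_ge1 k0_le P_homog delta_gt0 P_ge s.
have surj := @seqL_surj R n n_ge1 p k0 P delta p_ge1 k0_le P_homog delta_gt0 P_ge s s_homs.
split=> [k0_lt|k0_eq].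
  split=> [q Aq|q1 q2 /set_mem A1 /set_mem A2 eq12|f Af].
  - have [w qw] := analytic_rep n_ge1 rho_gt0 Aq.
    by apply: (rep_patch n_ge1 rho_gt0 (rep_diffop n_ge1 P_homog hs qw)).
  - have [w1 q1w] := analytic_rep n_ge1 rho_gt0 A1.
    have [w2 q2w] := analytic_rep n_ge1 rho_gt0 A2.
    have r1 := rep_diffop n_ge1 P_homog hs q1w; have r2 := rep_diffop n_ge1 P_homog hs q2w.
    have w12 : w1 = w2.
      apply: inj; [exact: q1w.1.1|exact: q2w.1.1|].
      apply/funeqP/(rep_inj n_ge1 rho_gt0 r1); apply: rep_ext r2 => x xr.
      by have := congr1 (@^~ x) eq12; rewrite !patch_in.
    by rewrite -w12 in q2w; apply: analytic_eq A1 A2 q1w q2w.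
  - have [v fv] := analytic_rep n_ge1 rho_gt0 Af.
    have [w hw wE] := surj v fv.1.1.
    have sw := seqL_summ_lt n_ge1 p_ge1 k0_le P_homog delta_gt0 P_ge s_homs s_summ k0_lt hw wE fv.1.
    have [q qw] := rep_exists n_ge1 sw.
    pose q' := patch (fun=> 0) (eball rho) q.
    have q'w : rep rho q' w by apply: rep_ext qw => x xr; rewrite /q' patch_in.
    exists q'; first exact: rep_patch qw.
    have r1 := rep_diffop n_ge1 P_homog hs q'w.
    have wv : seqL p k0 P s w = v by apply/funext.
    rewrite wv in r1; have [f0 _ _] := Af; apply/funext => x.
    case: (pselect (eball rho x)) => [xr|xr]; last by rewrite patch_out // f0.
    by rewrite patch_in //; apply: rep_fun_unique r1 fv x xr.
have [r [r0 rr hr]] := seqL_summ_eq n_ge1 p_ge1 k0_le P_homog delta_gt0 P_ge s_homs s_summ rho_gt0 k0_eq.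
exists r; split=> // f Af; have [v fv] := analytic_rep n_ge1 rho_gt0 Af.
have [w hw wE] := surj v fv.1.1.
have [q qw] := rep_exists n_ge1 (hr w v hw wE fv.1).
have wv : seqL p k0 P s w = v by apply/funext.
have fvr := rep_le rr fv.
pose q' := patch (fun=> 0) (eball r) q.
have q'w : rep r q' w by apply: rep_ext qw => x xr; rewrite /q' patch_in.
have Aq' : analytic_ball r q' by exact: rep_patch qw.
exists q'; split=> [|q2 [A2 h2]].
  split=> // x xr; have := rep_diffop n_ge1 P_homog (fun alpha => hs_le r alpha rr) q'w.
  by rewrite wv => r1; apply: rep_fun_unique r1 fvr x xr.
have [w2 q2w] := analytic_rep n_ge1 r0 A2.
have r2 := rep_diffop n_ge1 P_homog (fun alpha => hs_le r alpha rr) q2w.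
suff w2E : w2 = w by rewrite w2E in q2w; apply: analytic_eq Aq' A2 q'w q2w.
apply: inj => //; first exact: q2w.1.1.
move=> m; rewrite wE; congr (_ m); apply: (rep_inj n_ge1 r0 r2).
by apply: rep_ext fvr => x xr; rewrite h2.
Qed.
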